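(* Let $3\le n,n'\le\infty$ and suppose that the subgroups $\Gamma\le\mathrm{Sym}(n)$ and $\Gamma'\le\mathrm{Sym}(n')$ are discrete for the topology of pointwise convergence (which is automatic when $n,n'<\infty$). If the kaleidoscopic groups $\mathcal{K}(\Gamma)$ and $\mathcal{K}(\Gamma')$ are isomorphic as abstract groups, then $n=n'$ and $\Gamma\cong\Gamma'$ as permutation groups (that is, some bijection $[n]\to[n']$ conjugates $\Gamma$ onto $\Gamma'$).
   Context: A dendrite is a locally connected continuum (non-empty compact connected metrizable space) containing no simple closed curve. Any two distinct points $x,y$ of a dendrite $X$ are joined by a unique arc $[x,y]$; put $(x,y)=[x,y]\setminus\{x,y\}$. For $x\in X$, $\widehat{x}=\pi_0(X\setminus\{x\})$ is the (at most countable) set of components of $X\setminus\{x\}$; $x$ is a branch point if $|\widehat{x}|\ge 3$, and $\mathrm{Br}(X)$ is the (at most countable) set of branch points. For $3\le n\le\infty$ ($\infty$ meaning countably infinite), the Ważewski dendrite $D_n$ is the dendrite, unique up to homeomorphism, which is not a single point, in which $|\widehat{x}|=n$ for every branch point $x$, and in which $(x,y)$ contains a branch point for all $x\ne y$. Write $[n]=\{m\in\mathbf{N}: m<n\}$ (so $[\infty]=\mathbf{N}\ni 0$) and $\mathrm{Sym}(n)$ for the group of all permutations of $[n]$, with the topology of pointwise convergence. A coloring of $D_n$ is a map $c$ from $\widehat{D_n}=\bigsqcup_{x\in\mathrm{Br}(D_n)}\widehat{x}$ to $[n]$ whose restriction $c_x=c|_{\widehat{x}}$ is a bijection $\widehat{x}\to[n]$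 for each $x\in \mathrm{Br}(D_n)$; for $y\ne x$, $c_x(y)$ denotes the color of the component of $D_n\setminus\{x\}$ containing $y$. The coloring is kaleidoscopic if for all distinct $x,y\in\mathrm{Br}(D_n)$ and all distinct $i,j\in[n]$ there is $z\in(x,y)\cap\mathrm{Br}(D_n)$ with $c_z(x)=i$ and $c_z(y)=j$. For $g\in\mathrm{Homeo}(D_n)$ and $x\in\mathrm{Br}(D_n)$ put $\sigma_c(g,x)=c_{g(x)}\circ g\circ c_x^{-1}\in\mathrm{Sym}(n)$, where $g$ is viewed as a bijection $\widehat{x}\to\widehat{g(x)}$. For $\Gamma\le\mathrm{Sym}(n)$ put $\mathcal{K}_c(\Gamma)=\{g\in\mathrm{Homeo}(D_n):\sigma_c(g,x)\in\Gamma\ \text{for all } x\in\mathrm{Br}(D_n)\}$. Kaleidoscopic colorings exist and for any two of them, $c$ and $d$, the groups $\mathcal{K}_c(\Gamma)$ and $\mathcal{K}_d(\Gamma)$ are conjugate in $\mathrm{Homeo}(D_n)$; $\mathcal{K}(\Gamma)$ denotes $\mathcal{K}_c(\Gamma)$ for some (any) kaleidoscopic coloring $c$. *)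

(* Defs.v *)
From HB Require Import structures.
From mathcomp Require Import all_boot all_order all_algebra.
From mathcomp Require Import all_classical all_reals all_analysis.
Import numFieldTopology.Exports.

Set Implicit Arguments.
Unset Strict Implicit.
Unset Printing Implicit Defensive.

Import Order.TTheory GRing.Theory Num.Theory.

Local Open Scope classical_set_scope.
Local Open Scope ring_scope.
Local Open Scope card_scope.

Section SymmetricGroup.
Variable T : Type.

Record Sym := MkSym {
  sym_fun :> T -> T;
  sym_inv : T -> T;
  sym_funK : cancel sym_fun sym_inv;
  sym_invK : cancel sym_inv sym_fun
}.

Lemma symP (g h : Sym) : g =1 h -> g = h.
Proof.
case: g h => [g g' gK g'K] [h h' hK h'K] /= gh.
have gE : g = h by apply/funext.
have g'E : g' = h'.
  by apply/funext => x; rewrite -[x in LHS]h'K -gE gK.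
move: gK g'K hK h'K; rewrite gE g'E => gK g'K hK h'K.
by rewrite (Prop_irrelevance gK hK) (Prop_irrelevance g'K h'K).
Qed.

HB.instance Definition _ := gen_eqMixin Sym.
HB.instance Definition _ := gen_choiceMixin Sym.

Definition sym_one : Sym :=
  @MkSym id id (fun=> erefl) (fun=> erefl).

Definition sym_opp (g : Sym) : Sym := MkSym (sym_invK g) (sym_funK g).

Definition sym_mul (g h : Sym) : Sym :=
  MkSym (can_comp (sym_funK g) (sym_funK h))
        (can_comp (sym_invK h) (sym_invK g)).

Fact sym_mulA : associative sym_mul.
Proof. by move=> g h k; apply: symP. Qed.

Fact sym_mul1 : left_id sym_one sym_mul.
Proof. by move=> g; apply: symP. Qed.

Fact sym_mulr1 : right_id sym_one sym_mul.
Proof. by move=> g; apply: symP. Qed.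

Fact sym_mulV : left_inverse sym_one sym_opp sym_mul.
Proof. by move=> g; apply: symP => x; exact: sym_funK. Qed.

Fact sym_mulrV : right_inverse sym_one sym_opp sym_mul.
Proof. by move=> g; apply: symP => x; exact: sym_invK. Qed.

HB.instance Definition _ :=
  isGroup.Build Sym sym_mulA sym_mul1 sym_mulr1 sym_mulV sym_mulrV.

End SymmetricGroup.

Lemma sym_mulE T (g h : Sym T) : (g * h)%g = g \o h :> (T -> T).
Proof. by []. Qed.

Definition isomorphic_subgroups (G H : groupType) (A : set G) (B : set H) :=
  exists2 phi : G -> H, set_bij A B phi &
    {in A &, {morph phi : g h / (g * h)%g}}.

Definition permutation_isomorphic S T (A : set (Sym S)) (B : set (Sym T)) :=
  exists2 f : S -> T, bijective f &
    B = [set t : Sym T | exists2 s : Sym S, A s & t \o f = f \o s].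

(* The elements of [3, oo] are encoded in option nat, None being oo. *)
Definition at_least_three (n : option nat) : bool :=
  if n is Some k then (3 <= k)%N else true.

(* The set [n]; as a type, it carries the topology induced by the discrete
   topology of nat. *)
Definition segment (n : option nat) : set nat :=
  if n is Some k then `I_k else setT.

Definition discrete_subset (n : option nat) (Gamma : set (Sym (segment n))) :=
  let G : set {ptws segment n -> segment n} := @sym_fun _ @` Gamma in
  G `<=` isolated G.

Definition locally_connected (X : topologicalType) :=
  forall (x : X) (U : set X), nbhs x U ->
    exists V : set X, [/\ open V, V x, connected V & V `<=` U].

Section Dendrites.
Variables (R : realType) (X : metricType R).
Implicit Types (x y z : X).

(* X being Hausdorff and [0, 1] compact, these parametrizations give exactly the
   subspaces homeomorphic to a circle, resp. to [0, 1] with endpoints x, y. *)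
Definition simple_closed_curve (C : set X) :=
  exists f : R -> X, [/\ {within `[0, 1], continuous f}, f 0 = f 1,
    {in `[0, 1[ &, injective f} & C = f @` `[0, 1]].

Definition is_arc x y (A : set X) :=
  exists f : R -> X, [/\ {within `[0, 1], continuous f},
    {in `[0, 1] &, injective f}, f 0 = x, f 1 = y & A = f @` `[0, 1]].

Definition dendrite :=
  [/\ [set: X] !=set0, compact [set: X], connected [set: X],
      locally_connected X & ~ exists C, simple_closed_curve C].

(* The open arc (x, y); in a dendrite, A is unique. *)
Definition open_arc x y : set X :=
  [set z | exists2 A, is_arc x y A & (A `\` [set x; y]) z].

(* The component of X \ {x} containing y (empty when y = x). *)
Definition branch x y : set X := connected_component (~` [set x]) y.

(* pi_0(X \ {x}), each component being a subset of X. *)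
Definition branches x : set (set X) := branch x @` ~` [set x].

Definition Br : set X := [set x | `I_3 #<= branches x].

Definition wazewski_dendrite (n : option nat) :=
  [/\ dendrite, exists x y, x <> y,
      forall x, Br x -> branches x #= segment n &
      forall x y, x <> y -> exists2 z, open_arc x y z & Br z].

Section Colorings.
Variable n : option nat.

(* Only the values c x C with x in Br and C in branches x are relevant. *)
Definition coloring (c : X -> set X -> segment n) :=
  forall x, Br x -> set_bij (branches x) [set: segment n] (c x).

Definition kaleidoscopic (c : X -> set X -> segment n) :=
  coloring c /\
  forall x y, Br x -> Br y -> x <> y -> forall i j : segment n, i <> j ->
    exists z, [/\ open_arc x y z, Br z, c z (branch z x) = i &
                  c z (branch z y) = j].

Definition Homeo : set (Sym X) :=
  [set g : Sym X | continuous g /\ continuous (g^-1)%g].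

Definition local_action (c : X -> set X -> segment n) (g : X -> X) x :
    segment n -> segment n :=
  fun i => c (g x) (g @` 'pinv_(fun=> set0) (branches x) (c x) i).

Definition kaleidoscopic_group (c : X -> set X -> segment n)
    (Gamma : set (Sym (segment n))) : set (Sym X) :=
  [set g | Homeo g /\
    forall x, Br x -> exists2 s, Gamma s & sym_fun s = local_action c g x].

End Colorings.

End Dendrites.

(* Main.v *)
Require Import Defs.
From HB Require Import structures.
From mathcomp Require Import all_boot all_order all_algebra.
From mathcomp Require Import all_classical all_reals all_analysis.
From mathcomp Require Import ring lra.
Import numFieldTopology.Exports.
Import Order.TTheory GRing.Theory Num.Theory.

Set Implicit Arguments.
Unset Strict Implicit.
Unset Printing Implicit Defensive.

Local Open Scope classical_set_scope.
Local Open Scope card_scope.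

(** The branch points, with the color [k x y] at [x] of the branch containing
    [y], form a countable tree-like structure which determines the kaleidoscopic
    group: a bijection of the branch points preserving colors up to [Gamma]
    extends uniquely to a homeomorphism, by compactness, because any two points
    of the dendrite are separated by a branch point. A back-and-forth argument
    provides many elements of this group.

    The group is locally moving, so Rubin's commutator trick expresses
    disjointness of supports in terms of the group operation alone. For a branch
    point [x], the rigid stabilizers of the branches at [x] form a family (a
    "star") of at least three pairwise independent subgroups, with trivial common
    centralizer, each of them primitive, and nested with its conjugates; these
    conditions only involve disjointness, and conversely every star arises from
    some branch point. An isomorphism thus maps the star of [x] to the star of
    some [m]; since the stabilizer of [x] permutes the star of [x] as [Gamma]
    permutes the colors, the bijection between both stars conjugates [Gamma] onto
    [Gamma']. *)

(** * Colored trees *)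

(** The group sees points only through supports, so stars are stated for an abstract relation [ind],
    which the group operation defines and an isomorphism transports. A star yields its root in two
    steps. Primitivity forces the support of a member to lie in one branch at each point outside it,
    so points in the supports of three members determine a candidate root. Conjugating by elements
    supported in one branch at this root, nesting makes a member a block, and the primitivity of the
    rigid stabilizer of that branch makes the member all of it.

    The elements built to test independence and primitivity have trivial local actions, hence exist
    for every subgroup [Gamma]. Only the final comparison prescribes a local action: the same
    back-and-forth is run between a coloring and its twist at one point.

    That a point of an arc separates its ends is drawn from the coloring: the kaleidoscopic
    condition supplies separating points, and these accumulate at every interior point of an arc. *)

Section Structure.
Variables B T : choiceType.
Implicit Types (k : B -> B -> T) (x y z m : B).

Definition no_between k x y z :=
  [/\ k x y = k x z, k y x = k y z & k z x = k z y].

Definition median k m x y z :=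
  [/\ m <> x, m <> y & m <> z] /\
  [/\ k m x <> k m y, k m x <> k m z & k m y <> k m z].

(* [k x y] is the color at [x] of the branch containing [y]; it is junk when
   [x = y]. *)
Record kaleido k : Prop := Kaleido {
  kaleido_tree : forall x y z, x <> y -> x <> z -> k x y <> k x z ->
    k y x = k y z;
  kaleido_between : forall x y i j, x <> y -> i <> j ->
    exists z, [/\ z <> x, z <> y, k z x = i & k z y = j];
  kaleido_onto : forall x i, exists y, x <> y /\ k x y = i;
  kaleido_median : forall x y z, x <> y -> x <> z -> y <> z ->
    no_between k x y z -> exists m, median k m x y z
}.

End Structure.

Section Tree.
Variables (B T : choiceType) (k : B -> B -> T).
Hypothesis K : kaleido k.
Hypothesis T3 : exists a b c : T, [/\ a <> b, a <> c & b <> c].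
Implicit Types (x y z m : B) (i j : T).

(** The dichotomy behind all configuration arguments: either [x] does not separate [y] from [z], or
    it lies between them and each of them sees the other in the direction of [x]. Case analyses on
    it are closed by [congruence]. *)
Lemma treeP x y z : x <> y -> x <> z ->
  k x y = k x z \/ [/\ k x y <> k x z, y <> z, k y x = k y z & k z x = k z y].
Proof.
move=> xy xz; have [|n] := pselect (k x y = k x z); [by left|right].
split => //; first by congruence.
- exact: (kaleido_tree K).
- by apply: (kaleido_tree K) => // /esym.
Qed.

Lemma color_avoid i j : exists l : T, l <> i /\ l <> j.
Proof.
have [a [b [c [ab ac bc]]]] := T3.
have [ai|ai] := pselect (a = i); have [aj|aj] := pselect (a = j);
have [bi|bi] := pselect (b = i); have [bj|bj] := pselect (b = j);
by [exists a|exists b|exists c; split; congruence].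
Qed.

Lemma kaleido_at x i j : exists y, [/\ x <> y, k x y = i & k y x = j].
Proof.
have [y [xy kxy]] := kaleido_onto K x i.
have [|nj] := pselect (k y x = j); first by exists y.
have [l [lj _]] := color_avoid j j.
have [z [zx zy kzx kzy]] := kaleido_between K xy (nesym lj).
by exists z; split => //; [congruence|case: (treeP zx zy) => [|[]]; congruence].
Qed.

(** If the medians differ, at most one of the three points lies on the side of [m] facing [m']; the
    two others are then in one branch at [m'], that of [m]. *)
Lemma median_uniq m m' x y z : median k m x y z -> median k m' x y z -> m = m'.
Proof.
move=> [[mx my mz] [xy xz yz]] [[m'x m'y m'z] [xy' xz' yz']].
have [//|mm] := pselect (m = m').
by case: (treeP mm mx) (treeP mm my) (treeP mm mz) => [|[]] ? => [|???];
   case => [|[]] ? => [|???]; case => [|[]] ? => [|???]; congruence.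
Qed.

Lemma median_no_between m x y z : median k m x y z -> no_between k x y z.
Proof.
move=> [[mx my mz] [xy xz yz]].
by case: (treeP mx my) => [//|[_ _ ? ?]]; case: (treeP mx mz) => [//|[_ _ ? ?]];
   case: (treeP my mz) => [//|[_ _ ? ?]]; split; congruence.
Qed.

(** No other point of [s] separates [a] from [y]. In the induction, a new point [c] replaces [a]
    exactly when it separates [a] from [y]. *)
Lemma closest y (s : seq B) : y \notin s -> s != [::] ->
  exists2 a, a \in s & forall c, c \in s -> c <> a -> k c a = k c y.
Proof.
elim: s => // c s IH; rewrite inE negb_or => /andP[/eqP yc ys] _.
have [->|sn] := eqVneq s [::].
  by exists c => [|d]; rewrite inE // => /eqP.
have [a as_ ha] := IH ys sn.
have ya : y <> a by move=> e; rewrite e as_ in ys.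
have [ca|ca] := pselect (c = a).
  by exists a => [|d]; rewrite inE ?as_ ?orbT// => /predU1P[->//|]; apply: ha.
have [e|ne] := pselect (k c a = k c y).
  by exists a => [|d]; rewrite inE ?as_ ?orbT// => /predU1P[->//|]; apply: ha.
exists c; rewrite ?mem_head // => d; rewrite inE => /predU1P[->//|ds] dc.
have yd : y <> d by move=> ey; rewrite ey ds in ys.
case: (treeP ca (nesym yc)) => [//|[_ ay kac kyc]].
have [da|da] := pselect (d = a); first by subst d.
have := ha _ ds da.
case: (treeP dc (nesym yd)) => // -[]???? ?.
case: (treeP da dc) => [|[]]; case: (treeP ca (nesym dc))=> [|[]]; congruence.
Qed.

End Tree.

(* The domain is required to be closed under medians: without this, a partial
   isomorphism need not extend, the colors at a median being unconstrained. *)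
Record partial_iso (B T : choiceType) (k l : B -> B -> T) (s : seq (B * B)) :
  Prop := PartialIso {
  partial_inj : forall a a' b b', (a, a') \in s -> (b, b') \in s ->
    a = b <-> a' = b';
  partial_color : forall a a' b b', (a, a') \in s -> (b, b') \in s ->
    a <> b -> l a' b' = k a b;
  partial_median : forall a a' b b' c c', (a, a') \in s -> (b, b') \in s ->
    (c, c') \in s -> a <> b -> a <> c -> b <> c -> no_between k a b c ->
    exists p, p \in s /\ median k p.1 a b c
}.

Definition swap (B : Type) (p : B * B) := (p.2, p.1).

Lemma mem_swap (B : choiceType) (s : seq (B * B)) a b :
  ((a, b) \in map (@swap B) s) = ((b, a) \in s).
Proof.
apply/mapP/idP => [[[c d] cds [-> ->]]//|ab]; by exists (b, a).
Qed.

(** * Finite partial isomorphisms and back-and-forth *)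

Section PartialIso.
Variables (B T : choiceType) (k l : B -> B -> T).
Hypotheses (K : kaleido k) (L : kaleido l).
Hypothesis T3 : exists a b c : T, [/\ a <> b, a <> c & b <> c].
Implicit Types (s : seq (B * B)).

Lemma partial_iso_swap s :
  partial_iso k l s -> partial_iso l k (map (@swap B) s).
Proof.
move=> [inj col med]; split.
- by move=> a a' b b'; rewrite !mem_swap => ha hb; apply: iff_sym; apply: inj.
- move=> a a' b b'; rewrite !mem_swap => ha hb ab.
  by rewrite (col _ _ _ _ ha hb) // => /(inj _ _ _ _ ha hb).
- move=> a a' b b' c c'; rewrite !mem_swap => ha hb hc ab ac bc [e1 e2 e3].
  have ab' : a' <> b' by move=> /(inj _ _ _ _ ha hb).
  have ac' : a' <> c' by move=> /(inj _ _ _ _ ha hc).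
  have bc' : b' <> c' by move=> /(inj _ _ _ _ hb hc).
  have nb : no_between k a' b' c'.
    by split; rewrite -?(col _ _ _ _ ha hb) -?(col _ _ _ _ ha hc)
       -?(col _ _ _ _ hb hc) -?(col _ _ _ _ hb ha) -?(col _ _ _ _ hc hb)
       -?(col _ _ _ _ hc ha) //; apply: nesym.
  have [[m m'] [hm [[ma mb mc] [mab mac mbc]]]] :=
    med _ _ _ _ _ _ ha hb hc ab' ac' bc' nb.
  exists (m', m); rewrite mem_swap; split => //; split; split => /=.
  - by move=> /(inj _ _ _ _ hm ha).
  - by move=> /(inj _ _ _ _ hm hb).
  - by move=> /(inj _ _ _ _ hm hc).
  - by rewrite (col _ _ _ _ hm ha) // (col _ _ _ _ hm hb).
  - by rewrite (col _ _ _ _ hm ha) // (col _ _ _ _ hm hc).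
  - by rewrite (col _ _ _ _ hm hb) // (col _ _ _ _ hm hc).
Qed.

Lemma partial_iso_cons s y y' : partial_iso k l s ->
  (forall a a', (a, a') \in s ->
     [/\ a <> y, a' <> y', l a' y' = k a y & l y' a' = k y a]) ->
  (forall b b' c c', (b, b') \in s -> (c, c') \in s -> b <> c ->
     no_between k y b c -> exists p, p \in s /\ median k p.1 y b c) ->
  partial_iso k l ((y, y') :: s).
Proof.
move=> [inj col med] hy ym; split.
- move=> a a' b b'; rewrite !inE => /predU1P[[-> ->]|ha] /predU1P[[-> ->]|hb].
  + by [].
  + by have [? ? _ _] := hy _ _ hb; split => ?; congruence.
  + by have [? ? _ _] := hy _ _ ha; split => ?; congruence.
  + exact: inj ha hb.
- move=> a a' b b'; rewrite !inE => /predU1P[[-> ->]|ha] /predU1P[[-> ->]|hb] //.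
  + by have [] := hy _ _ hb.
  + by have [] := hy _ _ ha.
  + exact: col ha hb.
- have ext a b c : (exists p, p \in s /\ median k p.1 a b c) ->
      exists p, p \in (y, y') :: s /\ median k p.1 a b c.
    by move=> [p [ps mp]]; exists p; rewrite inE ps orbT.
  move=> a a' b b' c c'; rewrite !inE => /predU1P[[-> _]|ha] /predU1P[[-> _]|hb]
    /predU1P[[-> _]|hc] // ab ac bc nb; apply: ext.
  + exact: ym hb hc _ _.
  + have [[m m'] [ms [[? ? ?] [? ? ?]]]] := ym _ _ _ _ ha hc ac
      (let: And3 e1 e2 e3 := nb in And3 e2 e1 (esym e3)).
    exists (m, m'); split => //; split; split => //; exact: nesym.
  + have [[m m'] [ms [[? ? ?] [? ? ?]]]] := ym _ _ _ _ ha hb ab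
      (let: And3 e1 e2 e3 := nb in And3 e3 (esym e1) (esym e2)).
    exists (m, m'); split => //; split; split => //; exact: nesym.
  + exact: med ha hb hc _ _ _ _.
Qed.

Lemma extend_between s y a0 a0' b0 b0' : partial_iso k l s ->
  y \notin unzip1 s -> (a0, a0') \in s -> (b0, b0') \in s ->
  k y a0 <> k y b0 -> exists y', partial_iso k l ((y, y') :: s).
Proof.
move=> ps ys ha0 hb0 ab0; have [inj col med] := ps.
have s1 c c' : (c, c') \in s -> c \in unzip1 s by move=> h; apply/mapP; exists (c, c').
have sy c c' : (c, c') \in s -> y <> c.
  by move=> /s1 cs e; rewrite e cs in ys.
(* A third color at [y] would make [y] the median of three points of [s], hence a point of [s]. *)
have two c c' : (c, c') \in s -> k y c = k y a0 \/ k y c = k y b0.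
  move=> hc; have [?|n1] := pselect (k y c = k y a0); first by left.
  have [?|n2] := pselect (k y c = k y b0); first by right.
  have my : median k y c a0 b0.
    by split; split; [exact: sy hc|exact: sy ha0|exact: sy hb0|..].
  have [[m m'] [ms mm]] := med _ _ _ _ _ _ hc ha0 hb0 ltac:(congruence)
    ltac:(congruence) ltac:(congruence) (median_no_between K my).
  by case: (sy _ _ ms); apply: median_uniq my mm.
have side i c0 c0' : (c0, c0') \in s -> k y c0 = i ->
    exists a a', [/\ (a, a') \in s, k y a = i &
      forall c c', (c, c') \in s -> k y c = i -> c <> a -> k c a = k c y].
  move=> hc0 kc0; pose P := [seq p <- s | k y p.1 == i].
  have Pc c c' : ((c, c') \in P) = (k y c == i) && ((c, c') \in s).
    by rewrite mem_filter.
  have yP : y \notin unzip1 P.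
    by apply: contra ys => /mapP[p]; rewrite mem_filter => /andP[_ pP ->];
       exact: map_f.
  have P0 : unzip1 P != [::].
    have : (c0, c0') \in P by rewrite Pc kc0 eqxx.
    by case: (P).
  have [a /mapP[[a1 a'] haP -> /=] hcl] := closest K yP P0.
  move: haP; rewrite Pc => /andP[/eqP ka ha].
  exists a1, a'; split => // c c' hc kc ca; apply: hcl => //.
  by apply/mapP; exists (c, c') => //; rewrite Pc kc eqxx.
have [a [a' [ha kya cla]]] := side _ _ _ ha0 erefl.
have [b [b' [hb kyb clb]]] := side _ _ _ hb0 erefl.
have {side}ab : k y a <> k y b by congruence.
have two' c c' : (c, c') \in s -> k y c = k y a \/ k y c = k y b.
  by move=> /two; rewrite kya kyb.
have {two}anb : a <> b by congruence.
(* Otherwise s would contain the median of a1, b1 and c. *)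
have adj a1 a1' b1 b1' : (a1, a1') \in s -> (b1, b1') \in s ->
    k y a1 <> k y b1 ->
    (forall c c', (c, c') \in s -> k y c = k y a1 -> c <> a1 -> k c a1 = k c y) ->
    (forall c c', (c, c') \in s -> k y c = k y a1 \/ k y c = k y b1) ->
    forall c c', (c, c') \in s -> k y c = k y a1 -> c <> a1 ->
    k a1 c <> k a1 y.
  move=> h1 h2 n12 cl tw c c' hc kc ca e.
  have ya := sy _ _ h1; have yb := sy _ _ h2; have yc := sy _ _ hc.
  have kca := cl _ _ hc kc ca.
  case: (treeP K ya yb) => // -[_ ab1 kab kba].
  case: (treeP K yc yb) => [|[_ cb kcb kbc]]; first by congruence.
  have nb : no_between k a1 b1 c by split; congruence.
  have [[m m'] [ms [/= [ma mb mc] [mab mac mbc]]]] :=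
    med _ _ _ _ _ _ h1 h2 hc ab1 (nesym ca) (nesym cb) nb.
  have ym := sy _ _ ms.
  case: (tw _ _ ms) => kym.
    have := cl _ _ ms kym ma.
    by case: (treeP K ym yb) => [|[]]; congruence.
  case: (treeP K ym ya) => [|[]]; first by congruence.
  by case: (treeP K ym yc) => [|[]]; congruence.
have adja := adj _ _ _ _ ha hb ab ltac:(move=> c c' hc e; apply: (cla _ _ hc); congruence) two'.
have adjb := adj _ _ _ _ hb ha (nesym ab) ltac:(move=> c c' hc e; apply: (clb _ _ hc); congruence)
  ltac:(move=> c c' /two'[]; [by right|by left]).
have a'b' : a' <> b' by move=> /(inj _ _ _ _ ha hb).
have [y' [y'a y'b lya lyb]] := kaleido_between L a'b' ab.
have ya := sy _ _ ha; have yb := sy _ _ hb.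
have lab := col _ _ _ _ ha hb anb.
have lba := col _ _ _ _ hb ha (nesym anb).
case: (treeP K ya yb) => // -[_ _ kab kba].
case: (treeP L y'a y'b) => [|[_ _ lab' lba']]; first by congruence.
have near a1 a1' : (a1, a1') \in s -> y' <> a1' -> l y' a1' = k y a1 ->
    l a1' y' = k a1 y ->
    (forall c c', (c, c') \in s -> k y c = k y a1 -> c <> a1 ->
      k a1 c <> k a1 y) ->
    (forall c c', (c, c') \in s -> k y c = k y a1 -> c <> a1 ->
      k c a1 = k c y) ->
    forall c c', (c, c') \in s -> k y c = k y a1 ->
     [/\ c <> y, c' <> y', l c' y' = k c y & l y' c' = k y c].
  move=> h1 y'a1 e1 e2 ad cl c c' hc kc.
  have yc := sy _ _ hc; have [ca|ca] := pselect (c = a1).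
    have := inj _ _ _ _ hc h1; rewrite ca => -[/(_ erefl) -> _].
    by split => //; congruence.
  have c'a : c' <> a1' by move=> /(inj _ _ _ _ hc h1).
  have n := ad _ _ hc kc ca.
  have e3 := col _ _ _ _ h1 hc (nesym ca); have e4 := col _ _ _ _ hc h1 ca.
  case: (treeP L (nesym y'a1) (nesym c'a)) => [|[]]; first by congruence.
  by have := cl _ _ hc kc ca; split; congruence.
(* Points on the side of [a1] see [y] and [b1] in the same direction, so the median of [b1], [c],
   [d], which is in [s], is also that of [y], [c], [d]. *)
have cross a1 a1' b1 b1' : (a1, a1') \in s -> (b1, b1') \in s ->
    k y a1 <> k y b1 ->
    (forall c c', (c, c') \in s -> k y c = k y a1 \/ k y c = k y b1) ->
    forall c c' d d', (c, c') \in s -> (d, d') \in s -> c <> d ->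
      no_between k y c d -> k y c = k y a1 ->
      exists p, p \in s /\ median k p.1 y c d.
  move=> h1 h2 n12 tw c c' d d' hc hd cd [n1 n2 n3] kc.
  have yb1 := sy _ _ h2; have yc := sy _ _ hc; have yd := sy _ _ hd.
  case: (treeP K yc yb1) => [|[_ cb kcb kbc]]; first by congruence.
  case: (treeP K yd yb1) => [|[_ db kdb kbd]]; first by congruence.
  have nb : no_between k b1 c d by split; congruence.
  have [[m m'] [ms [/= [mb mc md] [mbc mbd mcd]]]] :=
    med _ _ _ _ _ _ h2 hc hd (nesym cb) (nesym db) cd nb.
  have ym := sy _ _ ms.
  exists (m, m'); split => //; case: (tw _ _ ms) => kym.
    case: (treeP K ym yb1) => [|[]]; first by congruence.
    by move=> *; split; split => //=; congruence.
  case: (treeP K ym yc) => [|[]]; first by congruence.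
  by case: (treeP K ym yd) => [|[]]; congruence.
exists y'; apply: partial_iso_cons => //.
- move=> c c' hc; case: (two' _ _ hc) => kc.
    by apply: (near a a' ha) => //; congruence ||
      (move=> d d' hd e; apply: (cla _ _ hd); congruence).
  by apply: (near b b' hb) => //; congruence ||
    (move=> d d' hd e; apply: (clb _ _ hd); congruence).
- move=> c c' d d' hc hd cd nb; case: (two' _ _ hc) => kc.
    exact: (cross _ _ _ _ ha hb ab two' _ _ _ _ hc hd).
  apply: (cross _ _ _ _ hb ha (nesym ab) _ _ _ _ _ hc hd) => // e e' /two'[]; by [right|left].
Qed.

(** Here [y] lies in a branch at [a] free of points of [s], so only the colors between [a] and [y]
    need matching. A new median is either [a] itself or a median of [a] and two points of [s]. *)
Lemma extend_outside s y a a' : partial_iso k l s -> y \notin unzip1 s ->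
  (a, a') \in s ->
  (forall c c', (c, c') \in s -> k y c = k y a) ->
  (forall c c', (c, c') \in s -> c <> a -> k a c <> k a y) ->
  exists y', partial_iso k l ((y, y') :: s).
Proof.
move=> ps ys ha kyc hac; have [inj col med] := ps.
have sy c c' : (c, c') \in s -> y <> c.
  by move=> cs e; case/negP: ys; apply/mapP; exists (c, c').
have ya := sy _ _ ha.
have [y' [a'y lay lya]] := kaleido_at L T3 a' (k a y) (k y a).
have sep c c' : (c, c') \in s -> c <> a -> k y c = k y a /\ k c y = k c a.
  move=> hc ca; have := hac _ _ hc ca.
  by case: (treeP K (nesym ya) (nesym ca)) => [?|[? ? ? ?]] ?; split; congruence.
exists y'; apply: partial_iso_cons => //.
- move=> c c' hc; have yc := sy _ _ hc.
  have [ca|ca] := pselect (c = a).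
    have := inj _ _ _ _ hc ha; rewrite ca => -[/(_ erefl) -> _].
    by split => //; exact: nesym.
  have c'a : c' <> a' by move=> /(inj _ _ _ _ hc ha).
  have := hac _ _ hc ca; have [e1 e2] := sep _ _ hc ca.
  rewrite -(col _ _ _ _ ha hc (nesym ca)) -lay.
  have e4 := col _ _ _ _ hc ha ca.
  by case: (treeP L a'y (nesym c'a)) => [?|[? ? ? ?]] ?; split; congruence.
- move=> b b' c c' hb hc bc [n1 n2 n3].
  have [ba|ba] := pselect (b = a).
    by have := hac _ _ hc ltac:(congruence); congruence.
  have [ca|ca] := pselect (c = a).
    by have := hac _ _ hb ltac:(congruence); congruence.
  have := hac _ _ hc ca; have := hac _ _ hb ba.
  have [? ?] := sep _ _ hc ca; have [? ?] := sep _ _ hb ba.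
  have [e|e] := pselect (k a b = k a c); last first.
    by exists (a, a'); split => //; split; split => //=; congruence.
  have nb : no_between k a b c by split; congruence.
  have [[m m'] [ms [/= [ma mb mc] [mab mac mbc]]]] :=
    med _ _ _ _ _ _ ha hb hc (nesym ba) (nesym ca) bc nb.
  have [? ?] := sep _ _ ms ma; have ? := sy _ _ ms.
  by exists (m, m'); split => //; split; split => //=; congruence.
Qed.

Lemma extend s y : partial_iso k l s -> s != [::] ->
  exists2 s', partial_iso k l s' & {subset s <= s'} /\ y \in unzip1 s'.
Proof.
move=> ps s0; have [ys|ys] := boolP (y \in unzip1 s); first by exists s; [|split].
have sy c c' : (c, c') \in s -> y <> c.
  by move=> cs e; case/negP: ys; apply/mapP; exists (c, c').
have done1 y' : partial_iso k l ((y, y') :: s) ->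
    exists2 s', partial_iso k l s' & {subset s <= s'} /\ y \in unzip1 s'.
  move=> p; exists ((y, y') :: s) => //; rewrite mem_head; split=> // z.
  by rewrite inE orbC => ->.
have u0 : unzip1 s != [::] by case: (s) s0.
have [a /mapP[[a1 a'] ha /= -> {a}] cl] := closest K ys u0; rename a1 into a.
have cl' c c' : (c, c') \in s -> c <> a -> k c a = k c y.
  by move=> hc; apply: cl; apply/mapP; exists (c, c').
have [[b [b' [c [c' [hb hc bc]]]]]|allc] := pselect (exists b b' c c',
    [/\ (b, b') \in s, (c, c') \in s & k y b <> k y c]).
  by have [y' /done1] := extend_between ps ys hb hc bc.
have {}allc c c' : (c, c') \in s -> k y c = k y a.
  move=> hc; apply: contrapT => n; apply: allc.
  by exists c, c', a, a'.
have [[b [b' [hb ba kab]]]|sepa] := pselect (exists b b',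
    [/\ (b, b') \in s, b <> a & k a b = k a y]); last first.
  have [|y' /done1 //] := extend_outside ps ys ha allc.
  by move=> c c' hc ca e; apply: sepa; exists c, c'.
have kba := cl' _ _ hb ba.
(* [m], where the way to [y] leaves the segment from [a] to [b], is not in [s] because [a] is
   closest to [y]. It separates [a] from [b], so it can be added first; [y] is then in a branch at
   [m] free of points of [s]. *)
have [m mm] := kaleido_median K (sy _ _ ha) (sy _ _ hb) (nesym ba)
  (And3 (esym (allc _ _ hb)) (esym kab) (esym kba)).
have [[my ma mb] [mya myb mab]] := mm.
have ms : m \notin unzip1 s.
  by apply/negP => /mapP[[m1 m'] h /= e]; subst m1; have := cl' _ _ h ma; congruence.
have [m' pm] := extend_between ps ms ha hb mab.
have [inj col med] := ps.
have [||||y' py] := @extend_outside ((m, m') :: s) y m m' pm.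
- by rewrite /= inE negb_or ys andbT; apply/eqP => /esym.
- exact: mem_head.
- have : k y m = k y a by case: (treeP K my ma) => [|[]]; congruence.
  by move=> e c c'; rewrite inE => /predU1P[[-> //]|/allc]; congruence.
- move=> c c'; rewrite inE => /predU1P[[-> //]|hc] cm e.
  have [ca|ca] := pselect (c = a); first by congruence.
  have [cb|cb] := pselect (c = b); first by congruence.
  have mc : median k m c a b by split; split; congruence.
  have [[p p'] [hp mp]] :=
    med _ _ _ _ _ _ hc ha hb ca cb (nesym ba) (median_no_between K mc).
  case/negP: ms; rewrite (median_uniq K mc mp).
  by apply/mapP; exists (p, p').
exists ((y, y') :: (m, m') :: s) => //; rewrite mem_head; split=> // z.
by rewrite !inE => ->; rewrite !orbT.
Qed.

End PartialIso.

Lemma extend_both (B T : choiceType) (k l : B -> B -> T) s y :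
  kaleido k -> kaleido l -> (exists a b c : T, [/\ a <> b, a <> c & b <> c]) ->
  partial_iso k l s -> s != [::] ->
  exists2 s', partial_iso k l s' /\ s' != [::] &
    [/\ {subset s <= s'}, y \in unzip1 s' & y \in unzip2 s'].
Proof.
move=> K L T3 ps s0; have [s1 p1 [ss1 y1]] := extend K L T3 y ps s0.
have s10 : map (@swap B) s1 != [::] by case: (s1) y1.
have [s2 p2 [ss2 y2]] := extend L K T3 y (partial_iso_swap p1) s10.
have s12 : {subset s1 <= map (@swap B) s2}.
  by move=> [a b] ab; rewrite mem_swap ss2// mem_swap.
exists (map (@swap B) s2); first split.
- exact: partial_iso_swap.
- by case: (s2) y2.
- split; first by move=> p /ss1 /s12.
  + by have [p /s12 ps1 ->] := mapP y1; exact: map_f.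
  + have [[p q] h -> /=] := mapP y2.
    by apply/mapP; exists (q, p) => //; rewrite mem_swap.
Qed.

(** Two colorings of the same points are allowed: [l = k] gives elements with prescribed values, and
    a twist of [k] at one point gives elements with a prescribed local action there. *)
Theorem back_and_forth (B T : choiceType) (k l : B -> B -> T) s :
  kaleido k -> kaleido l -> (exists a b c : T, [/\ a <> b, a <> c & b <> c]) ->
  countable [set: B] -> partial_iso k l s -> s != [::] ->
  exists2 h : Sym B, (forall x y, x <> y -> l (h x) (h y) = k x y) &
    forall a a', (a, a') \in s -> h a = a'.
Proof.
move=> K L T3 /countable_injP[f finj] ps s0.
pose P := {s | partial_iso k l s /\ s != [::]}.
have step (np : nat * P) : exists q : P,
    {subset sval np.2 <= sval q} /\ forall y, f y = np.1 ->
    y \in unzip1 (sval q) /\ y \in unzip2 (sval q).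
  case: np => n [t [pt t0]] /=.
  have [[y fy]|nf] := pselect (exists y, f y = n); last first.
    by exists (exist _ t (conj pt t0)); split => // y fy; case: nf; exists y.
  have [t' pt' [tt' y1 y2]] := extend_both y K L T3 pt t0.
  exists (exist _ t' pt'); split => //= z fz.
  by have <- : y = z by apply: finj; rewrite ?inE ?fz.
have [next hnext] := choice step.
pose S := fix S n : P := if n is m.+1 then next (m, S m)
  else exist _ s (conj ps s0).
have SS m n : (m <= n)%N -> {subset sval (S m) <= sval (S n)}.
  elim: n => [|n IH]; first by rewrite leqn0 => /eqP ->.
  rewrite leq_eqVlt => /predU1P[->//|/IH h] z /h.
  by have [h' _] := hnext (n, S n); exact: h'.
pose R a b := exists n, (a, b) \in sval (S n).
have R2 a a' b b' : R a a' -> R b b' -> exists n,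
    (a, a') \in sval (S n) /\ (b, b') \in sval (S n).
  move=> [i hi] [j hj]; exists (maxn i j).
  by rewrite (SS _ _ (leq_maxl i j)) ?(SS _ _ (leq_maxr i j)).
have Rinj a a' b b' : R a a' -> R b b' -> a = b <-> a' = b'.
  move=> ha /(R2 _ _ _ _ ha)[n [h1 h2]].
  exact: (partial_inj (proj1 (proj2_sig (S n))) h1 h2).
have Rdom a : exists b, R a b.
  have [_ /(_ _ erefl)[/mapP[[x y] h -> _]]] := hnext (f a, S (f a)).
  by exists y, (f a).+1.
have Rcod b : exists a, R a b.
  have [_ /(_ _ erefl)[_ /mapP[[x y] h ->]]] := hnext (f b, S (f b)).
  by exists x, (f b).+1.
have [h hR] := choice Rdom; have [g gR] := choice Rcod.
have hK : cancel h g by move=> a; apply/(Rinj _ _ _ _ (gR _) (hR _)).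
have gK : cancel g h by move=> a; apply/(Rinj _ _ _ _ (hR _) (gR _)).
exists (MkSym hK gK) => [x y xy|a a' ha] /=.
  have [n [hx hy]] := R2 _ _ _ _ (hR x) (hR y).
  exact: (partial_color (proj1 (proj2_sig (S n))) hx hy).
by apply/(Rinj _ _ _ _ (hR a) (ex_intro _ 0%N ha)).
Qed.

(** * Groups of a colored tree *)

Definition halftree (B T : choiceType) (k : B -> B -> T) x i : set B :=
  [set y | x <> y /\ k x y = i].

Definition kaleido_group (B T : choiceType) (k : B -> B -> T)
    (Gamma : set (Sym T)) : set (Sym B) :=
  [set g | forall x, exists2 s, Gamma s &
     forall y, x <> y -> k (g x) (g y) = s (k x y)].

Definition rist (B T : choiceType) (k : B -> B -> T) (Gamma : set (Sym T)) x i :=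
  [set g | kaleido_group k Gamma g /\ forall y, ~ halftree k x i y -> g y = y].

Lemma sym_inj (S : Type) (g : Sym S) x y : g x = g y -> x = y.
Proof. exact: (can_inj (sym_funK g)). Qed.

Lemma sym_neq (S : Type) (g : Sym S) x y : x <> y -> g x <> g y.
Proof. by move=> xy e; apply: xy; exact: sym_inj e. Qed.

Lemma symVK (S : Type) (g : Sym S) x : (g^-1)%g (g x) = x.
Proof. exact: sym_funK. Qed.

Lemma symKV (S : Type) (g : Sym S) x : g ((g^-1)%g x) = x.
Proof. exact: sym_invK. Qed.

Lemma symM (S : Type) (g h : Sym S) x : (g * h)%g x = g (h x).
Proof. by []. Qed.

Lemma symX (S : Type) (g : Sym S) n x : (g ^+ n)%g x = iter n g x.
Proof. by elim: n x => // n IH x; rewrite expgS symM IH. Qed.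

Lemma sym_neq1 (S : Type) (g : Sym S) : g <> 1%g -> exists x, g x <> x.
Proof.
move=> g1; apply: contrapT => n; apply: g1; apply: symP => x.
by apply: contrapT => gx; apply: n; exists x.
Qed.

Section Halves.
Variables (B T : choiceType) (k : B -> B -> T).
Hypothesis K : kaleido k.
Hypothesis T3 : exists a b c : T, [/\ a <> b, a <> c & b <> c].

Lemma halftree_nonempty x i : exists y, halftree k x i y.
Proof. exact: (kaleido_onto K). Qed.

Lemma sub_halftree x i y : x <> y -> ~ halftree k x i y ->
  halftree k x i `<=` halftree k y (k y x).
Proof.
move=> xy nh z [xz kxz]; have ki : k x y <> i by move=> e; apply: nh.
by case: (treeP K xy xz) => [|[]]; split; congruence.
Qed.

Lemma halftree_inner x i (zs : seq B) : exists y, halftree k x i y /\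
  forall z, z \in zs -> [\/ z = y, z = x, k x z <> i |
    [/\ y <> x, y <> z & k y x <> k y z]].
Proof.
elim: zs => [|z zs [y [[xy kxy] hy]]].
  by have [y hy] := halftree_nonempty x i; exists y.
have keep : [\/ z = y, z = x, k x z <> i |
    [/\ y <> x, y <> z & k y x <> k y z]] -> exists y, halftree k x i y /\
  forall z', z' \in z :: zs -> [\/ z' = y, z' = x, k x z' <> i |
    [/\ y <> x, y <> z' & k y x <> k y z']].
  by move=> h; exists y; split=> // z'; rewrite inE => /predU1P[->//|]; exact: hy.
have [zy|zy] := pselect (z = y); first by apply: keep; constructor 1.
have [zx|zx] := pselect (z = x); first by apply: keep; constructor 2.
have [kz|kz] := pselect (k x z = i); last by apply: keep; constructor 3.
have [kyxz|kyxz] := pselect (k y x = k y z); last first.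
  by apply: keep; constructor 4; split => //; exact: nesym.
suff [m [mx my kmx hm]] : exists m, [/\ m <> x, m <> y, k m x <> k m y &
   m = z \/ m <> z /\ k m x <> k m z].
  exists m; case: (treeP K mx my) => // -[_ _ e1 e2]; split.
    by split; [exact: nesym|congruence].
  move=> z'; rewrite inE => /predU1P[->|/hy[->|->|?|[? yz ?]]].
  - by case: hm => [->|[? ?]]; [constructor 1|constructor 4].
  - by constructor 4.
  - by constructor 2.
  - by constructor 3.
  - case: (treeP K (nesym my) yz) => [|[_ mz e3 e4]]; first by congruence.
    by constructor 4; split; congruence.
have [kzxy|kzxy] := pselect (k z x = k z y); last first.
  by exists z; split => //; left.
have [|m [[? ? ?] [? ? ?]]] := kaleido_median K xy (nesym zx) (nesym zy).
  by split => //; congruence.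
by exists m; split => //; right.
Qed.

(** Half-trees containing [x] serve as its neighborhoods; finitely many of them contain a common
    half-tree. It hangs off a point [w] between [x] and the [y] of [halftree_inner], by a third
    color, other than those toward [x] and [y]. *)
Lemma halftree_common x (zs : seq B) : (forall z, z \in zs -> z <> x) ->
  exists w j, forall z, z \in zs -> halftree k w j `<=` halftree k z (k z x).
Proof.
move=> hz; have [i [j [l [ij il jl]]]] := T3.
have [y [[xy kxy] hy]] := halftree_inner x i zs.
have [w [wx wy kwx kwy]] := kaleido_between K xy ij.
case: (treeP K wx wy) => [|[_ _ kxw kyw]]; first by congruence.
exists w, l => z zs_; have zx := hz _ zs_.
suff [wz kzw kwz] : [/\ w <> z, k z w = k z x & k w z <> l].
  by rewrite -kzw; apply: sub_halftree => // -[].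
case: (hy _ zs_) => [zy|//|kz|[_ yz kyz]].
- by subst z; split => //; congruence.
- by case: (treeP K (nesym zx) (nesym wx)) => [|[]]; split; congruence.
- case: (treeP K (nesym xy) yz) => // -[_ _ e1 e2].
  by case: (treeP K (nesym wy) yz) => [|[]]; split; congruence.
Qed.

End Halves.

Section Group.
Variables (B T : choiceType) (k : B -> B -> T) (Gamma : set (Sym T)).
Hypothesis K : kaleido k.
Hypothesis T3 : exists a b c : T, [/\ a <> b, a <> c & b <> c].
Hypothesis cB : countable [set: B].
Hypothesis hG : group_closed [in Gamma].

Notation G := (kaleido_group k Gamma).
Notation rist := (rist k Gamma).
Notation halftree := (halftree k).

Lemma Gamma1 : Gamma 1%g.
Proof. by case: hG => + _; rewrite inE. Qed.

Lemma GammaV s : Gamma s -> Gamma (s^-1)%g.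
Proof.
by have [h1 hd] := hG; move=> gs; have := hd 1%g s h1; rewrite !inE div1g; exact.
Qed.

Lemma GammaM s t : Gamma s -> Gamma t -> Gamma (s * t)%g.
Proof.
have [h1 hd] := hG; move=> gs /GammaV gt; have := hd s (t^-1)%g; rewrite !inE invgK.
by apply.
Qed.

Lemma group1 : G 1%g.
Proof. by move=> x; exists 1%g => //; exact: Gamma1. Qed.

Lemma groupM g h : G g -> G h -> G (g * h)%g.
Proof.
move=> Gg Gh x; have [t Gt ht] := Gh x; have [s Gs hs] := Gg (h x).
exists (s * t)%g; first exact: GammaM.
move=> y xy; rewrite !symM hs; last exact: sym_neq.
by rewrite ht.
Qed.

Lemma groupV g : G g -> G (g^-1)%g.
Proof.
move=> Gg x; have [s Gs hs] := Gg ((g^-1)%g x).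
exists (s^-1)%g; first exact: GammaV.
move=> y xy; have := hs ((g^-1)%g y); rewrite !symKV => ->; last exact: sym_neq.
by rewrite symVK.
Qed.

Lemma groupX g n : G g -> G (g ^+ n)%g.
Proof.
by move=> Gg; elim: n => [|n IH]; rewrite ?expg0 ?expgS; [exact: group1|exact: groupM].
Qed.

Lemma halftree_image g x : G g -> exists2 s, Gamma s &
  forall i y, halftree (g x) (s i) (g y) <-> halftree x i y.
Proof.
move=> /(_ x)[s Gs hs]; exists s => // i y; split => -[xy e]; split.
- by move=> e'; apply: xy; rewrite e'.
- by apply: (@sym_inj _ s); rewrite -hs// => e'; apply: xy; rewrite e'.
- exact: sym_neq.
- by rewrite hs// e.
Qed.

(* An element moving x carries a neighborhood of x off itself; z separates x
   from g x. *)
Lemma halftree_moved x (gs : seq (Sym B)) (zs : seq B) :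
  (forall g, g \in gs -> G g /\ g x <> x) -> (forall z, z \in zs -> z <> x) ->
  exists w j, (forall z, z \in zs -> halftree w j `<=` halftree z (k z x)) /\
    forall g, g \in gs -> forall y, halftree w j y -> ~ halftree w j (g y).
Proof.
move=> hg hz.
have [i [j [_ [ij _ _]]]] := T3.
have sepP (g : Sym B) : exists z, g x <> x ->
    [/\ z <> x, z <> g x & k z x <> k z (g x)].
  have [e|n] := pselect (g x = x); first by exists x.
  have [z [zx zg e1 e2]] := kaleido_between K (nesym n) ij.
  by exists z => _; split => //; congruence.
have [f hf] := choice sepP.
(* At [f g], the half-trees toward [x] and toward [g x] are disjoint, and [g] maps the half-tree at
   [g^-1 (f g)] toward [x] onto the second one. A set inside the first whose image is inside the
   second is displaced by [g]. *)
pose ws := zs ++ [seq f g | g : Sym B <- gs] ++ [seq (g^-1)%g (f g) | g : Sym B <- gs].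
have hws z : z \in ws -> z <> x.
  rewrite !mem_cat => /or3P[/hz//|/mapP[g /hg[Gg /hf[? ? ?]] ->//]|].
  move=> /mapP[g /hg[Gg /hf[? ? ?]] ->] e; have := symKV g (f g).
  by rewrite e => /esym.
have [w [l hw]] := halftree_common K T3 hws.
exists w, l; split => [z zs_|g gs_ y Vy Vgy].
  by apply: hw; rewrite mem_cat zs_.
have [Gg /hf[fx fg nk]] := hg _ gs_.
have h1 : f g \in ws by rewrite !mem_cat map_f ?orbT.
have h2 : (g^-1)%g (f g) \in ws.
  by rewrite !mem_cat (map_f (fun g : Sym B => (g^-1)%g (f g))) ?orbT.
have [s _ hs] := halftree_image ((g^-1)%g (f g)) Gg.
have [_ e1] := hw _ h1 _ Vgy; have := hw _ h2 _ Vy.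
rewrite -hs symKV => -[_ e2].
have /hs : halftree ((g^-1)%g (f g)) (k ((g^-1)%g (f g)) x) x by split => //; exact: hws.
by rewrite symKV => -[_ e3]; congruence.
Qed.

Lemma rist_fix w j g : rist w j g -> g w = w.
Proof. by move=> [_]; apply => -[]. Qed.

Lemma rist_half w j g y : rist w j g -> halftree w j (g y) <-> halftree w j y.
Proof.
move=> [Gg h]; split => hy; apply: contrapT => n.
  by case: (n); rewrite -(h _ n).
by case: (n); rewrite (sym_inj (h _ n)).
Qed.

Lemma ristV w j g : rist w j g -> rist w j (g^-1)%g.
Proof.
move=> [Gg h]; split; first exact: groupV.
by move=> y /h e; apply: (@sym_inj _ g); rewrite symKV.
Qed.

(** A color-preserving [h] fixing [w] preserves the half-tree, so it can be replaced by the identity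
    outside. Colors survive because points on opposite sides of the cut see each other in the
    direction of [w]. All local actions are trivial, so any subgroup [Gamma] will do. *)
Lemma rist_extend w j s : partial_iso k k s -> (w, w) \in s ->
  exists2 g, rist w j g & forall a a', (a, a') \in s -> halftree w j a -> g a = a'.
Proof.
move=> ps ws; have s0 : s != [::] by case: (s) ws.
have [h hk hs] := back_and_forth K K T3 cB ps s0.
have hw := hs _ _ ws.
have hh y : halftree w j (h y) <-> halftree w j y.
  split => -[wy e]; have wy' : w <> y by congruence.
    by split => //; rewrite -hk// hw.
  split; first by move=> e'; apply: wy; apply: (@sym_inj _ h); rewrite hw.
  by rewrite -{1}hw hk.
have hv y : halftree w j ((h^-1)%g y) <-> halftree w j y by rewrite -hh symKV.
pose g y := if pselect (halftree w j y) then h y else y.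
pose gi y := if pselect (halftree w j y) then (h^-1)%g y else y.
have gK : cancel g gi.
  move=> y; rewrite /g; case: pselect => hy; rewrite /gi; case: pselect => // hy'.
    by rewrite symVK.
  by case: hy'; apply/hh.
have gV : cancel gi g.
  move=> y; rewrite /gi; case: pselect => hy; rewrite /g; case: pselect => // hy'.
    by rewrite symKV.
  by case: hy'; apply/hv.
have mixed a b : halftree w j a -> ~ halftree w j b ->
    k a b = k a w /\ (b <> w -> k b a = k b w).
  move=> ha nb; have [e|wb] := pselect (b = w); first by subst b.
  have [wa kwa] := ha; have kwb : k w b <> j by move=> e; apply: nb; split => //; exact: nesym.
  by case: (treeP K wa (nesym wb)) => [|[]]; split; congruence.
exists (MkSym gK gV); last first.
  by move=> a a' ha Ha /=; rewrite /g; case: pselect => //= ?; exact: hs.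
split => [x|y n] /=; last by rewrite /g; case: pselect.
exists 1%g; first exact: Gamma1.
move=> y xy; rewrite /= /g; case: pselect => /= hx; case: pselect => //= hy.
- by rewrite hk.
- have [-> _] := mixed _ _ hx hy.
  have /hh hx' := hx; have [-> _] := mixed _ _ hx' hy.
  by rewrite -{1}hw hk//; case: hx => ? ?; exact: nesym.
- have /hh hy' := hy.
  have [e|xw] := pselect (x = w); first by subst x; rewrite -{1}hw hk.
  have [_ ->//] := mixed _ _ hy' hx.
  by have [_ ->] := mixed _ _ hy hx.
Qed.

Lemma partial_iso2 a b c : a <> b -> a <> c -> k a b = k a c -> k b a = k c a ->
  partial_iso k k [:: (a, a); (b, c)].
Proof.
move=> ab ac e1 e2; split.
- move=> x x' y y'; rewrite !inE => /orP[]/eqP[-> ->] /orP[]/eqP[-> ->];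
  by split; congruence.
- by move=> x x' y y'; rewrite !inE => /orP[]/eqP[-> ->] /orP[]/eqP[-> ->] ?;
  congruence.
- move=> x x' y y' z z'; rewrite !inE => /orP[]/eqP[-> _] /orP[]/eqP[-> _]
  /orP[]/eqP[-> _]; congruence.
Qed.

Lemma rist_move w j p q : halftree w j p -> halftree w j q -> k p w = k q w ->
  exists2 g, rist w j g & g p = q.
Proof.
move=> [wp kp] [wq kq] e; have [g rg hg] := rist_extend j
  (partial_iso2 wp wq (etrans kp (esym kq)) e) (mem_head _ _).
by exists g => //; apply: hg => //; rewrite !inE eqxx orbT.
Qed.

(** Sending [p] to a point beyond it, with the same color toward [w], pushes everything ever farther
    from [w]. This provides elements with nontrivial 12th power. *)
Lemma rist_aperiodic w j : exists2 g, rist w j g &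
  exists p, halftree w j p /\ forall n, (0 < n)%N -> iter n g p <> p.
Proof.
have [p [wp kp]] := halftree_nonempty K w j.
have [l [lp _]] := color_avoid T3 (k p w) (k p w).
have [q [pq kpq kqp]] := kaleido_at K T3 p l (k p w).
case: (treeP K (nesym wp) pq) => [|[_ wq kwp kqw]]; first by congruence.
have [g rg gp] := @rist_move w j p q (conj wp kp)
  (conj wq (etrans (esym kwp) kp)) ltac:(congruence).
exists g => //; exists p; split => // n n0.
have [s _ hs] := halftree_image p (proj1 rg).
(* Everything at or beyond p, seen from w, is mapped strictly beyond p. *)
pose D y := p <> y /\ k p y <> k p w.
have step y : p = y \/ D y -> D (g y).
  move=> [<-|[py ky]]; first by rewrite gp; split; congruence.
  have [gpy e] := (hs (k p y) y).2 (conj py erefl).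
  have [gpw ew] := (hs (k p w) w).2 (conj (nesym wp) erefl).
  rewrite (rist_fix rg) gp in gpw ew; rewrite gp in gpy e.
  have n1 : k q w <> k q (g y) by rewrite ew e; apply: sym_neq; exact: nesym.
  case: (treeP K (nesym pq) gpy) => [|[_ ? ? _]]; first by congruence.
  by split; congruence.
suff [h _] : D (iter n g p) by exact: nesym.
case: n n0 => // n _; elim: n => [|n IH]; first by apply: step; left.
by rewrite iterS; apply: step; right.
Qed.

Lemma rist_nontrivial w j : exists2 g, rist w j g & g <> 1%g.
Proof.
have [g rg [p [_ /(_ 1%N isT) /= gp]]] := rist_aperiodic w j.
by exists g => // e; apply: gp; rewrite e.
Qed.

End Group.

(** * Rubin's criterion for disjoint supports *)

(** Commuting alone says too little, since an element commutes with its own powers. Quantifying over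
    all [h] not commuting with [f] probes small pieces of the support of [f]: any nontrivial [h]
    supported in a half-tree displaced by [f] qualifies. *)
Definition algebraically_disjoint (H : groupType) (A : set H) f g :=
  forall h, A h -> ~ commute f h -> exists f1 f2,
    [/\ A f1, A f2, commute f1 g & commute f2 g] /\
    [~ h, f1, f2]%g <> 1%g /\ commute [~ h, f1, f2]%g g.

(* In a kaleidoscopic group, the elements whose support lies in the regular open
   hull of that of f. *)
Definition hull (H : groupType) (A : set H) f : set H :=
  [set h | A h /\ forall g, A g -> algebraically_disjoint A f g ->
     commute h (g ^+ 12)%g].

Definition independent (H : groupType) (A : set H) f g :=
  forall h, hull A f h -> hull A g h -> h = 1%g.

Definition disjoint_support (S : Type) (f g : Sym S) :=
  forall x, f x = x \/ g x = x.

Section Supports.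
Variable S : Type.
Implicit Types (f g h : Sym S) (V : set S).

Definition supported V g := forall x, ~ V x -> g x = x.

Lemma commuteE f g x : commute f g -> f (g x) = g (f x).
Proof. by move=> e; rewrite -!symM e. Qed.

Lemma disjoint_support_commute f g : disjoint_support f g -> commute f g.
Proof.
move=> d; apply: symP => x; rewrite !symM.
have [fx|gx] := d x.
  have [e|e] := d (g x); first by rewrite fx.
  by rewrite fx; have := sym_inj e => ->; rewrite fx.
have [e|e] := d (f x); last by rewrite gx e.
by rewrite gx; have := sym_inj e => ->; rewrite gx.
Qed.

Lemma supported_disjoint V f g : supported V f -> (forall x, V x -> g x = x) ->
  disjoint_support f g.
Proof.
by move=> h1 h2 x; have [Vx|Vx] := pselect (V x); [right; exact: h2|left; exact: h1].
Qed.

Lemma supportedV V g : supported V g -> supported V (g^-1)%g.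
Proof. by move=> h x /h e; rewrite -{1}e symVK. Qed.

Lemma displaced_not_commute V f h : supported V h -> h <> 1%g ->
  (forall x, V x -> ~ V (f x)) -> ~ commute f h.
Proof.
move=> sh /sym_neq1[x hx] fV c.
have Vx : V x by apply: contrapT => /sh.
have := commuteE x c; rewrite (sh (f x)); last exact: fV.
by move=> e; apply: hx; exact: sym_inj e.
Qed.

Lemma symR h f x : [~ h, f]%g x = (h^-1)%g ((f^-1)%g (h (f x))).
Proof. by []. Qed.

Lemma support_commutator h f V x : supported V h -> [~ h, f]%g x <> x ->
  V x \/ V (f x).
Proof.
move=> sh; apply: contra_notP => /not_orP[Vx Vfx].
by rewrite symR sh// symVK; apply: (supportedV sh).
Qed.

Lemma commute_expg f g n : commute f g -> forall x, f (iter n g x) = iter n g (f x).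
Proof. by move=> c; elim: n => //= n IH x; rewrite commuteE// IH. Qed.

End Supports.

Section Rubin.
Variables (B T : choiceType) (k : B -> B -> T) (Gamma : set (Sym T)).
Hypothesis K : kaleido k.
Hypothesis T3 : exists a b c : T, [/\ a <> b, a <> c & b <> c].
Hypothesis cB : countable [set: B].
Hypothesis hG : group_closed [in Gamma].

Notation G := (kaleido_group k Gamma).
Notation rist := (rist k Gamma).
Notation halftree := (halftree k).

Lemma rist_not_commute w j : exists f1 f2,
  [/\ rist w j f1, rist w j f2 & ~ commute f1 f2].
Proof.
have [g rg g1] := rist_nontrivial K T3 cB hG w j; have [x gx] := sym_neq1 g1.
have wx : w <> x by move=> e; apply: gx; rewrite -e; exact: rist_fix rg.
have [||v [i [hv hg]]] := @halftree_moved _ _ _ Gamma K T3 x [:: g] [:: w].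
- by move=> h; rewrite inE => /eqP ->; split => //; case: rg.
- by move=> z; rewrite inE => /eqP ->.
have [h [Gh rh] h1] := rist_nontrivial K T3 cB hG v i.
have sub : halftree v i `<=` halftree w j.
  have <- : k w x = j.
    have : halftree w j x by apply: contrapT => n; apply: gx; case: rg => _; exact.
    by case.
  by apply: hv; rewrite mem_head.
exists g, h; split => //.
  by split => // y n; apply: rh => /sub.
exact: displaced_not_commute rh h1 (hg _ (mem_head _ _)).
Qed.

(** Some point is moved by both [f] and [h], as they do not commute; take a half-tree that both
    displace. There [g] is the identity, so elements supported in it commute with [g], and the
    double commutator reduces to [[~ f1, f2]], nontrivial for a suitable pair. *)
Lemma disjoint_support_algebraic f g : G f -> G g ->
  disjoint_support f g -> algebraically_disjoint G f g.
Proof.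
move=> Gf Gg d h Gh nc.
have [x [fx hx]] : exists x, f x <> x /\ h x <> x.
  apply: contrapT => n; apply: nc; apply: disjoint_support_commute => x.
  have [|fx] := pselect (f x = x); [by left|right].
  by apply: contrapT => hx; apply: n; exists x.
have [|//|w [j [_ hw]]] := @halftree_moved _ _ _ Gamma K T3 x [:: f; h] [::].
  by move=> g'; rewrite !inE => /orP[]/eqP ->.
have fw := hw f (mem_head _ _).
have hhw : forall y, halftree w j y -> ~ halftree w j (h y).
  by apply: hw; rewrite !inE eqxx orbT.
have gw y : halftree w j y -> g y = y.
  by move=> wy; case: (d y) => // e; case: (fw _ wy); rewrite e.
have cg f' : rist w j f' -> commute f' g.
  by move=> [_ r]; apply: disjoint_support_commute; exact: supported_disjoint r gw.
have [f1 [f2 [r1 r2 nc12]]] := rist_not_commute w j.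
have [[G1 s1] [G2 s2]] := (r1, r2).
exists f1, f2; split; first by split; [..|exact: cg|exact: cg].
(* On the half-tree, [h, f1] acts as f1, since f1 ^ h is supported elsewhere. *)
have hf1 y : halftree w j y -> (f1^-1)%g (h (f1 y)) = h (f1 y).
  by move=> wy; apply: (supportedV s1); apply: hhw; apply/(rist_half _ r1).
have hf y : halftree w j y -> [~ h, f1]%g y = f1 y.
  by move=> wy; rewrite symR hf1// symVK.
have ch y : halftree w j y -> ([~ h, f1]^-1)%g y = (f1^-1)%g y.
  move=> wy; have wy' : halftree w j ((f1^-1)%g y).
    by apply/(rist_half _ (ristV hG r1)).
  by rewrite -{1}(symKV f1 y) -hf// symVK.
have cf y : halftree w j y -> [~ h, f1, f2]%g y = [~ f1, f2]%g y.
  move=> wy; rewrite !(symR _ f2).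
  have w2 : halftree w j (f2 y) by apply/(rist_half _ r2).
  rewrite hf// ch//.
  by apply/(rist_half _ (ristV hG r2)); apply/(rist_half _ r1).
have sc y : ~ halftree w j y -> [~ h, f1, f2]%g y = y.
  move=> wy; rewrite symR s2//.
  rewrite (supportedV s2) ?symVK// => wc; apply: wy.
  by rewrite -(symVK [~ h, f1]%g y) ch//; apply/(rist_half _ (ristV hG r1)).
split.
  move=> e; apply: nc12; apply/commgP/eqP; apply: symP => y.
  have [wy|wy] := pselect (halftree w j y); first by rewrite -cf// e.
  apply: contrapT => ne.
  by case: (support_commutator s1 ne) => //; rewrite s2.
by apply: disjoint_support_commute; exact: supported_disjoint sc gw.
Qed.

End Rubin.

Section RubinConverse.
Variables (B T : choiceType) (k : B -> B -> T) (Gamma : set (Sym T)).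
Hypothesis K : kaleido k.
Hypothesis T3 : exists a b c : T, [/\ a <> b, a <> c & b <> c].
Hypothesis cB : countable [set: B].
Hypothesis hG : group_closed [in Gamma].

Notation G := (kaleido_group k Gamma).
Notation rist := (rist k Gamma).
Notation halftree := (halftree k).

(* The exponent 12 makes the points x, g x, ..., g^4 x distinct, whereas the
   support of a double commutator is covered by four translates of V. *)
Lemma algebraically_disjoint_support f g x : G f -> G g ->
  algebraically_disjoint G f g -> f x = x \/ (g ^+ 12)%g x = x.
Proof.
move=> Gf Gg ad; have [|fx] := pselect (f x = x); [by left|right].
apply: contrapT => gx.
have gn n : (0 < n < 5)%N -> (g ^+ n)%g x <> x.
  move=> n5 e; apply: gx; have [m ->] : exists m, 12 = (m * n)%N.
    by case: n n5 e => [|[|[|[|[|]]]]] // _ _; [exists 12|exists 6|exists 4|exists 3].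
  by rewrite symX iterM iter_fix// -symX.
have [||w [j [_ hw]]] := @halftree_moved _ _ _ Gamma K T3 x
  [:: f, g, (g ^+ 2)%g, (g ^+ 3)%g & [:: (g ^+ 4)%g]] [::].
- have gx1 : g x <> x by have := gn 1%N isT; rewrite expg1.
  move=> h; rewrite !inE => /or4P[/eqP->|/eqP->|/eqP->|/orP[]/eqP->];
    split => //; by [exact: groupX|exact: gn].
- by [].
pose V := halftree w j.
have gV n y : (0 < n < 5)%N -> V y -> ~ V (iter n g y).
  case: n => [|[|[|[|[|]]]]] // _; rewrite -?symX.
  - by apply: (hw g); rewrite !inE eqxx ?orbT.
  - by apply: (hw (g ^+ 2)%g); rewrite !inE eqxx ?orbT.
  - by apply: (hw (g ^+ 3)%g); rewrite !inE eqxx ?orbT.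
  - by apply: (hw (g ^+ 4)%g); rewrite !inE eqxx ?orbT.
have [h [Gh sh] h1] := rist_nontrivial K T3 cB hG w j.
have [f1 [f2 [[_ _ c1 c2] [n1 cg]]]] := ad h Gh
  (displaced_not_commute sh h1 (hw f (mem_head _ _))).
have [y cy] := sym_neq1 n1.
(* If none of these maps sends [z] into [V], then [[~ h, f1]] fixes both [z] and [f2 z], so the
   double commutator fixes [z]. All four commute with [g]. *)
pose W : 'I_4 -> B -> B := fun i => nth id [:: id; f1 : B -> B; f2 : B -> B; f1 \o f2] i.
have Wg i n z : W i (iter n g z) = iter n g (W i z).
  case: i => -[|[|[|[|]]]] // hi; rewrite /W /=; rewrite ?commute_expg //.
have sW z : [~ h, f1, f2]%g z <> z -> exists i, V (W i z).
  rewrite symR => hz.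
  have [v1|v1] := pselect (V z); first by exists (@Ordinal 4 0 isT).
  have [v2|v2] := pselect (V (f1 z)); first by exists (@Ordinal 4 1 isT).
  have [v3|v3] := pselect (V (f2 z)); first by exists (@Ordinal 4 2 isT).
  have [v4|v4] := pselect (V (f1 (f2 z))); first by exists (@Ordinal 4 3 isT).
  have fixc u : ~ V u -> ~ V (f1 u) -> [~ h, f1]%g u = u.
    by move=> n u1; apply: contrapT => /(support_commutator sh)[].
  case: hz; rewrite fixc// symVK.
  by apply: (@sym_inj _ [~ h, f1]%g); rewrite symKV fixc.
(* The double commutator commutes with [g], so it moves all five points [iter i g y]; two of them
   must share one of the four maps. *)
have cgy (i : 'I_5) : exists l : 'I_4, V (W l (iter i g y)).
  apply: sW; rewrite commute_expg// => e; apply: cy.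
  by move: e; rewrite -!symX; exact: sym_inj.
have [l hl] := choice cgy.
have /injectivePn[i1 [i2 i12 e]] : ~~ injectiveb l.
  apply/negP => /injectiveP/leq_card; by rewrite !card_ord.
wlog lt : i1 i2 i12 e / (i1 < i2)%N.
  move=> H; have [lt|lt|eq] := ltngtP i1 i2; first exact: (H i1 i2).
    by apply: (H i2 i1) => //; rewrite eq_sym.
  by move/eqP: i12; apply; exact: val_inj.
apply: (gV (i2 - i1)%N (W (l i1) (iter i1 g y))) => //.
  rewrite subn_gt0 lt /=; exact: leq_ltn_trans (leq_subr _ _) (ltn_ord i2).
by rewrite -Wg -iterD subnK 1?ltnW// e.
Qed.

Lemma moved_neq1 (S : Type) (g : Sym S) x : g x <> x -> g <> 1%g.
Proof. by move=> gx e; apply: gx; rewrite e. Qed.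

(** If [f] fixed the half-tree pointwise, it would be algebraically disjoint from all of [rist w j],
    and [h] would commute with the 12th power of an aperiodic element there, although it displaces
    the support of that power. *)
Lemma hull_meets f h w j : G f -> hull G f h ->
  (forall z, halftree w j z -> ~ halftree w j (h z)) ->
  exists2 y, halftree w j y & f y <> y.
Proof.
move=> Gf [Gh hh] hw; apply: contrapT => n.
have fw y : halftree w j y -> f y = y.
  by move=> wy; apply: contrapT => fy; apply: n; exists y.
have [g [Gg sg] [p [wp gp]]] := rist_aperiodic K T3 cB hG w j.
have s12 : supported (halftree w j) (g ^+ 12)%g.
  by move=> y wy; rewrite symX iter_fix// sg.
have : ~ commute h (g ^+ 12)%g.
  apply: displaced_not_commute s12 _ hw; apply: (@moved_neq1 _ _ p).
  by rewrite symX; apply: gp.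
apply; apply: hh => //; apply: disjoint_support_algebraic => //.
by move=> y; case: (supported_disjoint sg fw y); [right|left].
Qed.

(** A nontrivial element of both hulls displaces a half-tree; [hull_meets] yields a smaller one
    displaced by [f], then a point of it moved by [g]. Conversely, a half-tree displaced by both [f]
    and [g] carries elements lying in both hulls. *)
Lemma disjoint_supportP f g : G f -> G g ->
  disjoint_support f g <-> independent G f g.
Proof.
move=> Gf Gg; split => [d h Wf Wg|ind x].
  apply: contrapT => /sym_neq1[x hx].
  have Gh : G h by case: Wf.
  have [||w [j [_ /(_ h (mem_head _ _)) hw]]] :=
    @halftree_moved _ _ _ Gamma K T3 x [:: h] [::]; [|by []|].
    by move=> h'; rewrite inE => /eqP ->.
  have [y wy fy] := hull_meets Gf Wf hw.
  have wny : w <> y by case: wy.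
  have [||v [i [hv hvf]]] := @halftree_moved _ _ _ Gamma K T3 y [:: f] [:: w].
  - by move=> h'; rewrite inE => /eqP ->.
  - by move=> z; rewrite inE => /eqP ->.
  have sub : halftree v i `<=` halftree w j.
    by have := hv w (mem_head _ _); case: wy => _ ->.
  have [z vz gz] : exists2 z, halftree v i z & g z <> z.
    by apply: (hull_meets Gg Wg) => z /sub wz /sub; exact: hw.
  by case: (d z) => // e; case: (hvf f (mem_head _ _) z vz); rewrite e.
have [|fx] := pselect (f x = x); [by left|right]; apply: contrapT => gx.
have [||w [j [_ hw]]] := @halftree_moved _ _ _ Gamma K T3 x [:: f; g] [::]; [|by []|].
  by move=> h'; rewrite !inE => /orP[]/eqP ->.
have [h [Gh sh] h1] := rist_nontrivial K T3 cB hG w j.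
have inhull f' : G f' -> f' \in [:: f; g] -> hull G f' h.
  move=> Gf' fin; split => // g' Gg' ad.
  apply: disjoint_support_commute; apply: (supported_disjoint sh) => y wy.
  have [e|//] := algebraically_disjoint_support y Gf' Gg' ad.
  by case: (hw _ fin _ wy); rewrite e.
apply: h1; apply: ind; apply: inhull => //; rewrite !inE eqxx ?orbT //.
Qed.

End RubinConverse.

(** * Stars *)

Section Stars.
Variables (H : groupType) (A : set H) (ind : H -> H -> Prop).

Definition perp (S : set H) : set H :=
  [set g | A g /\ forall s, S s -> ind g s].

(** With disjointness of supports for [ind], these play the part of rigid stabilizers of regular
    open sets. *)
Definition regular (S : set H) := perp (perp S) = S.

(** As [h ^ g] is [g^-1 h g], this is [g S g^-1]. *)
Definition conj_set (g : H) (S : set H) : set H := [set h | S (h ^ g)%g].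

(** Primitivity as for permutation groups, with [S] acting by conjugation on its regular subsets: a
    block is a nontrivial [D] each of whose conjugates equals it or is independent of it. *)
Definition primitive_set (S : set H) := forall D, regular D -> D `<=` S ->
  (exists2 d, D d & d <> 1%g) ->
  (forall g, S g -> conj_set g D = D \/
    forall d e, D d -> conj_set g D e -> ind d e) ->
  D = S.

(** Nesting excludes families such as the rigid stabilizers of all half-trees hanging off a segment,
    which satisfy the other conditions. [star_total] ensures that no branch at the root is
    missed. *)
Record star (I : Type) (S : I -> set H) : Prop := Star {
  star_regular : forall i, regular (S i);
  star_nontrivial : forall i, exists2 s, S i s & s <> 1%g;
  star_ind : forall i j s t, i <> j -> S i s -> S j t -> ind s t;
  star_total : forall g, A g -> (forall i s, S i s -> ind g s) -> g = 1%g;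
  star_nested : forall g i, A g -> (exists j, conj_set g (S i) `<=` S j) \/
    exists j, forall l, l <> j -> S l `<=` conj_set g (S i);
  star_primitive : forall i, primitive_set (S i)
}.

End Stars.

Section StarsOfHalftrees.
Variables (B T : choiceType) (k : B -> B -> T) (Gamma : set (Sym T)).
Hypothesis K : kaleido k.
Hypothesis T3 : exists a b c : T, [/\ a <> b, a <> c & b <> c].
Hypothesis cB : countable [set: B].
Hypothesis hG : group_closed [in Gamma].

Notation G := (kaleido_group k Gamma).
Notation rist := (rist k Gamma).
Notation halftree := (halftree k).
Notation perp := (perp G (@disjoint_support B)).
Notation regular := (regular G (@disjoint_support B)).

Lemma disjoint_supportC (f g : Sym B) :
  disjoint_support f g -> disjoint_support g f.
Proof. by move=> d x; case: (d x); [right|left]. Qed.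

Lemma regular_sub S g : regular S -> S g -> G g.
Proof. by move=> <- []. Qed.

Lemma regularI S S' : regular S -> regular S' -> regular (S `&` S').
Proof.
move=> hS hS'; apply/seteqP; split => [g [Gg hg]|g [Sg S'g]].
  split.
    rewrite -hS; split => // h [Gh hh]; apply: hg; split => // s [Ss _]; exact: hh.
  rewrite -hS'; split => // h [Gh hh]; apply: hg; split => // s [_ Ss]; exact: hh.
split; first exact: regular_sub hS Sg.
by move=> h [_ hh]; apply: disjoint_supportC; apply: hh.
Qed.

Lemma regular_mem S g : regular S -> G g ->
  (forall x, g x <> x -> exists2 s, S s & s x <> x) -> S g.
Proof.
move=> hS Gg hg; rewrite -hS; split => // h [_ hh] x.
have [|/hg[s Ss sx]] := pselect (g x = x); [by left|right].
by have [] := hh s Ss x.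
Qed.

Lemma rist_sub_regular S w j : regular S ->
  (forall y, halftree w j y -> exists2 s, S s & s y <> y) -> rist w j `<=` S.
Proof.
move=> hS hw g [Gg sg]; apply: regular_mem => // x gx; apply: hw.
by apply: contrapT => /sg.
Qed.

Lemma rist_sub w j v i : halftree w j `<=` halftree v i -> rist w j `<=` rist v i.
Proof. by move=> h g [Gg sg]; split => // y n; apply: sg => /h. Qed.

Lemma rist_moves w j y : halftree w j y -> exists2 g, rist w j g & g y <> y.
Proof.
move=> [wy ky]; have [l [ly _]] := color_avoid T3 (k y w) (k y w).
have [q [yq kyq kqy]] := kaleido_at K T3 y l (k y w).
case: (treeP K (nesym wy) yq) => [|[_ wq kwy kqw]]; first by congruence.
have [|g rg gy] := @rist_move _ _ _ _ K T3 cB hG w j y q (conj wy ky)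
  (conj wq (etrans (esym kwy) ky)); first by congruence.
by exists g => //; rewrite gy; exact: nesym.
Qed.

Lemma rist_support w j y g : rist w j g -> g y <> y -> halftree w j y.
Proof. by move=> [_ h] gy; apply: contrapT => /h. Qed.

Lemma halftree_root x j y l : halftree x j = halftree y l -> x = y.
Proof.
move=> e; apply: contrapT => xy.
have kxy : k x y <> j.
  move=> kj; have : halftree x j y by split.
  by rewrite e => -[].
have [z xz] := halftree_nonempty K x j; have := xz; rewrite e => -[yz kyz].
have [xz' kxz] := xz.
have : halftree y l x.
  case: (treeP K xy xz') => [|[]]; first by congruence.
  by move=> *; split; [exact: nesym|congruence].
by rewrite -e => -[].
Qed.

Lemma fix_root x j g : G g -> (forall y, halftree x j y -> g y = y) -> g x = x.
Proof.
move=> Gg fix_; have [s _ hs] := halftree_image x Gg.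
apply/esym/(@halftree_root _ j _ (s j)); apply/seteqP; split => y hy.
  by rewrite -(fix_ _ hy); apply/hs.
have : halftree x j ((g^-1)%g y) by apply/hs; rewrite symKV.
by move=> h; have := h; rewrite -(fix_ _ h) symKV.
Qed.

Lemma rist_disjoint x i j g h : i <> j -> rist x i g -> rist x j h ->
  disjoint_support g h.
Proof.
move=> ij [_ sg] [_ sh]; apply: supported_disjoint sg _ => y [_ ki].
by apply: sh => -[_]; congruence.
Qed.

(** This is where [Gamma] becomes visible in the group: if [g] fixes [x], conjugation by [g]
    permutes the star of [x] by the local action of [g]. *)
Lemma conj_rist g x : G g -> exists2 s, Gamma s &
  (forall y, x <> y -> k (g x) (g y) = s (k x y)) /\
  forall i, conj_set g (rist x i) = rist (g x) (s i).
Proof.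
move=> Gg; have [s Gs hs'] := Gg x; exists s => //; split => // i.
have hs y : halftree (g x) (s i) (g y) <-> halftree x i y.
  split => -[xy e]; split.
  - by move=> e'; apply: xy; rewrite e'.
  - by apply: (@sym_inj _ s); rewrite -hs' // => e'; apply: xy; rewrite e'.
  - exact: sym_neq.
  - by rewrite hs' // e.
apply/seteqP; split => h [Gh hh].
  split.
    have := groupM hG (groupM hG Gg Gh) (groupV hG Gg).
    by rewrite /conjg !mulgA mulgV mul1g -mulgA mulgV mulg1.
  move=> y hy; have := hh ((g^-1)%g y).
  rewrite /conjg !symM symKV -hs symKV => /(_ hy) /(congr1 g).
  by rewrite !symKV.
split; first by apply: (groupM hG (groupV hG Gg)); exact: groupM.
move=> y hy; rewrite /conjg !symM hh ?symVK//.
by move/hs.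
Qed.

(** An element of the double [perp] is disjoint from every [rist x j] with [j <> i]. As these move
    all points of their half-trees, it fixes those half-trees, and their root [x] with them. *)
Lemma regular_rist x i : regular (rist x i).
Proof.
apply/seteqP; split => [g [Gg hg]|g rg]; last first.
  split; first by case: rg.
  by move=> h [_ hh]; apply: disjoint_supportC; exact: hh.
have fixj j y : j <> i -> halftree x j y -> g y = y.
  move=> ji xy; have [h rh hy] := rist_moves xy.
  have : perp (rist x i) h.
    by split; [case: rh|move=> s rs; exact: rist_disjoint rh rs].
  by move=> /hg /(_ y)[].
split => // y n; have [l [li _]] := color_avoid T3 i i.
have [xy|xy] := pselect (x = y).
  by rewrite -xy; apply: (@fix_root x l) => // z; apply: fixj.
by apply: (@fixj (k x y)) => // e; apply: n.
Qed.

(** For a proper block [D], regularity gives a half-tree [b] fixed by [D], besides a half-tree [a]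
    moved by some [d0] in [D]. If [g] maps one point of [a] into [a] and another into [b], the
    conjugate of [D] by [g] is neither equal to [D] nor independent of it. *)
Lemma primitive_rist x i : primitive_set G (@disjoint_support B) (rist x i).
Proof.
move=> D rD Dx [d0 Dd0 d01] blk; apply/seteqP; split => // r rr.
apply: contrapT => nDr.
have [h [[Gh hD] [y [ry hy]]]] : exists h, perp D h /\ exists y, r y <> y /\ h y <> y.
  apply: contrapT => n; apply: nDr; rewrite -rD; split; first by case: rr.
  move=> h hD y; have [|ry] := pselect (r y = y); [by left|right].
  by apply: contrapT => hy; apply: n; exists h; split => //; exists y.
have hxy := rist_support rr ry.
have local g z : G g -> g z <> z -> halftree x i z -> exists w j,
    halftree w j `<=` halftree x i /\ forall y, halftree w j y -> g y <> y.
  move=> Gg gz [xz kxz].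
  have [||w [j [hw1 hw2]]] := @halftree_moved _ _ _ Gamma K T3 z [:: g] [:: x].
  - by move=> g'; rewrite inE => /eqP ->.
  - by move=> g'; rewrite inE => /eqP ->.
  exists w, j; split; first by rewrite -kxz; apply: hw1; rewrite mem_head.
  by move=> u hu e; apply: (hw2 g (mem_head _ _) u hu); rewrite e.
have [b [jb [subb mb]]] := local _ _ Gh hy hxy.
have [z d0z] := sym_neq1 d01.
have hxz := rist_support (Dx _ Dd0) d0z.
have [a [ja [suba ma]]] := local _ _ (regular_sub rD Dd0) d0z hxz.
have ab u : halftree a ja u -> ~ halftree b jb u.
  by move=> /ma au /mb bu; case: (hD _ Dd0 u).
have [p' ap'] := halftree_nonempty K a ja.
have [q' bq'] := halftree_nonempty K b jb.
have [xp' kxp'] := suba _ ap'; have [xq' kxq'] := subb _ bq'.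
have nax : ~ halftree a ja x by move=> /suba [].
have nbx : ~ halftree b jb x by move=> /subb [].
have naq : ~ halftree a ja q' by move=> /ab.
have nbp : ~ halftree b jb p' by move=> bp; exact: ab ap' bp.
have pq' : p' <> q' by move=> e; apply: naq; rewrite -e.
have exit w j u v : halftree w j u -> ~ halftree w j v -> k u v = k u w.
  move=> [wu kwu] nv; have [e|wv] := pselect (w = v); first by rewrite e.
  case: (treeP K wu wv) => [e|[]]; last by congruence.
  by case: nv; split => //; congruence.
have pxq : k p' x = k p' q' by rewrite (exit _ _ _ _ ap' nax) (exit _ _ _ _ ap' naq).
have qxp : k q' x = k q' p' by rewrite (exit _ _ _ _ bq' nbx) (exit _ _ _ _ bq' nbp).
have [//|m' mm'] := kaleido_median K xp' xq' pq'; first by split; congruence.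
have [[m'x m'p m'q] [xpm xqm pqm]] := mm'.
case: (treeP K m'x m'p) => // -[_ _ kxm' kp'm'].
case: (treeP K m'x m'q) => // -[_ _ kxm2 kq'm'].
have eax : a <> x -> k x a = i.
  move=> ax; have [ap ka] := ap'.
  case: (treeP K ax ap) => [e|[]]; last by congruence.
  by case: nax; split => //; congruence.
have ax : a <> x.
  move=> e; subst a; have [_ kp] := ap'.
  apply: naq; split => //; congruence.
(* [m], [p], [q] form a copy inside [a] of [m'], [p'], [q'], with the same colors among themselves
   and toward [x]. The center [m] is needed because the domain must be closed under medians. *)
have [m [am kam kma]] := kaleido_at K T3 a ja (k m' x).
have hm : halftree a ja m by [].
have [xm kxm] := suba _ hm.
have kmx := exit _ _ _ _ hm nax.
have [p [mp kmp kpm]] := kaleido_at K T3 m (k m' p') (k p' m').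
have [q [mq kmq kqm]] := kaleido_at K T3 m (k m' q') (k q' m').
case: (treeP K (nesym xm) mp) => [|[_ xp kxmp kpmx]]; first by congruence.
case: (treeP K (nesym xm) mq) => [|[_ xq kxmq kqmx]]; first by congruence.
case: (treeP K mp mq) => [|[_ pq kpmq kqmp]]; first by congruence.
have inC u : m <> u -> k m u <> k m x -> halftree a ja u.
  move=> mu ku; case: (treeP K (nesym am) mu) => [e|[_ au e1 e2]].
    by congruence.
  by split => //; congruence.
have hp : halftree a ja p by apply: inC => //; congruence.
have hq : halftree a ja q by apply: inC => //; congruence.
have piso : partial_iso k k [:: (x, x); (m, m'); (p, p'); (q, q')].
  split.
  - move=> u u' v v'; rewrite !inE => /or4P[]/eqP[-> ->] /or4P[]/eqP[-> ->];
      split; congruence.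
  - move=> u u' v v'; rewrite !inE => /or4P[]/eqP[-> ->] /or4P[]/eqP[-> ->] ?;
      congruence.
  - move=> u u' v v' w w'; rewrite !inE.
    move=> /or4P[]/eqP[-> _] /or4P[]/eqP[-> _] /or4P[]/eqP[-> _] // uv uw vw [n1 n2 n3];
    try congruence;
    exists (m, m'); rewrite !inE eqxx !orbT; split => //;
    split; split => /=; congruence.
have [g rg hg] := rist_extend K T3 cB hG i piso (mem_head _ _).
have gp : g p = p' by apply: hg; [rewrite !inE eqxx !orbT|apply: suba].
have gq : g q = q' by apply: hg; [rewrite !inE eqxx !orbT|apply: suba].
have conjD u : d0 u <> u -> exists2 e, conj_set g D e & e (g u) <> g u.
  move=> d0u; exists (d0 ^ (g^-1))%g; first by rewrite /conj_set /= -conjgM mulVg conjg1.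
  rewrite /conjg invgK !symM symVK; exact: sym_neq.
case: (blk g rg) => [e|dis].
  have [e' De' qe] := conjD q (ma _ hq).
  rewrite e in De'; rewrite gq in qe.
  by have := mb _ bq'; case: (hD _ De' q').
have [e' De' pe] := conjD p (ma _ hp).
by rewrite gp in pe; case: (dis _ _ Dd0 De' p') => //; exact: ma.
Qed.

End StarsOfHalftrees.

Section StarsAreHalftrees.
Variables (B T : choiceType) (k : B -> B -> T) (Gamma : set (Sym T)).
Hypothesis K : kaleido k.
Hypothesis T3 : exists a b c : T, [/\ a <> b, a <> c & b <> c].
Hypothesis cB : countable [set: B].
Hypothesis hG : group_closed [in Gamma].

Notation G := (kaleido_group k Gamma).
Notation rist := (rist k Gamma).
Notation halftree := (halftree k).
Notation perp := (perp G (@disjoint_support B)).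
Notation regular := (regular G (@disjoint_support B)).
Notation star := (star G (@disjoint_support B)).

Lemma star_rist x : star (rist x).
Proof.
split.
- by move=> i; exact: regular_rist.
- by move=> i; exact: rist_nontrivial.
- by move=> i j s t; exact: rist_disjoint.
- move=> g Gg hg; have fix_ y : x <> y -> g y = y.
    move=> xy; have hy : halftree x (k x y) y by [].
    have [s rs sy] := rist_moves (Gamma := Gamma) K T3 cB hG hy.
    by case: (hg _ _ rs y).
  apply: symP => y; have [<-|xy] := pselect (x = y); last exact: fix_.
  have [i _] := T3.
  by apply: (@fix_root _ _ _ _ K x i g Gg) => z [xz _]; exact: fix_.
- move=> g i Gg; have [s _ [_ hs]] := conj_rist hG x Gg.
  have [gx|gx] := pselect (g x = x).
    by left; exists (s i); rewrite hs gx.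
  (* The image half-tree is rooted at [g x]. Either it misses [x] and lies in the half-tree at [x]
     toward [g x], or it contains [x] and all the other half-trees at [x]. *)
  have [nx|nx] := pselect (halftree (g x) (s i) x); last first.
    left; exists (k x (g x)); rewrite hs; apply: rist_sub.
    exact: sub_halftree.
  right; exists (k x (g x)) => l lx; rewrite hs; apply: rist_sub.
  have [_ <-] := nx; apply: sub_halftree => //; first exact: nesym.
  by move=> [_ e]; apply: lx.
- by move=> i; exact: primitive_rist.
Qed.

Lemma regularM S g h : regular S -> S g -> S h -> S (g * h)%g.
Proof.
move=> <- [Gg hg] [Gh hh]; split; first exact: groupM.
move=> s Ss x; have [hx|] := hh s Ss x; last by right.
by have [gx|] := hg s Ss x; [left; rewrite symM hx|right].
Qed.

Lemma regularV S g : regular S -> S g -> S (g^-1)%g.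
Proof.
move=> <- [Gg hg]; split; first exact: groupV.
move=> s Ss x; have [gx|] := hg s Ss x; last by right.
by left; rewrite -{1}gx symVK.
Qed.

Lemma local_halftree g x (zs : seq B) : G g -> g x <> x ->
  (forall z, z \in zs -> z <> x) -> exists w j,
  (forall z, z \in zs -> halftree w j `<=` halftree z (k z x)) /\
  forall y, halftree w j y -> g y <> y.
Proof.
move=> Gg gx hz; have [||w [j [h1 h2]]] := @halftree_moved _ _ _ Gamma K T3 x [:: g] zs.
- by move=> g'; rewrite inE => /eqP ->.
- exact: hz.
- exists w, j; split => // y wy e; apply: (h2 g (mem_head _ _) y wy); by rewrite e.
Qed.

Section StarIsRist.
Variables (I : Type) (S : I -> set (Sym B)).
Hypothesis hS : star S.

Let O i : set B := [set x | exists2 s, S i s & s x <> x].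

Let SG i s : S i s -> G s.
Proof. exact: regular_sub (star_regular hS i). Qed.

(** All of [S i] fixes [z], hence permutes the half-trees at [z]; so the elements of [S i] supported
    in the half-tree of [x] form a block, which by primitivity is [S i]. *)
Lemma star_convex i z x y : ~ O i z -> O i x -> O i y ->
  halftree z (k z x) y.
Proof.
move=> nz [s Ss sx] [t St ty].
have fz s' : S i s' -> s' z = z.
  by move=> Ss'; apply: contrapT => n; apply: nz; exists s'.
have zx : z <> x by move=> e; apply: nz; exists s; rewrite ?e.
pose D := S i `&` rist z (k z x).
suff DS : D = S i.
  have [_ rt] : D t by rewrite DS.
  exact: rist_support rt ty.
apply: (star_primitive hS) => [|g []//||g Sg].
- exact: regularI (star_regular hS i) (regular_rist K T3 cB hG z (k z x)).
- have [|w [j [hw1 hw2]]] := @local_halftree s x [:: z] (SG Ss) sx.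
    by move=> z'; rewrite inE => /eqP ->.
  have [g rg g1] := rist_nontrivial K T3 cB hG w j.
  exists g => //; split.
    apply: (rist_sub_regular (star_regular hS i) _ rg) => u wu.
    by exists s => //; exact: hw2.
  by apply: rist_sub rg; apply: hw1; rewrite mem_head.
- have [s' _ [hk hs']] := conj_rist hG z (SG Sg).
  have := hs' (k z x); rewrite (fz _ Sg) => e'.
  have rS := star_regular hS i.
  have Sgg h : S i (h ^ g)%g <-> S i h.
    split => [h'|Sh]; last first.
      by apply: (regularM rS (regularV rS Sg)); exact: (regularM rS Sh Sg).
    have := regularM rS (regularM rS Sg h') (regularV rS Sg).
    by rewrite /conjg !mulgA mulgV mul1g -mulgA mulgV mulg1.
  have cD : conj_set g D = S i `&` rist z (s' (k z x)).
    by rewrite -e'; apply/seteqP; split => h -[h1 h2]; split => //; exact/Sgg.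
  have [e|ne] := pselect (s' (k z x) = k z x); first by left; rewrite cD e.
  right => d e [_ rd]; rewrite cD => -[_ re].
  by apply: rist_disjoint rd re; exact: nesym.
Qed.

(* The nesting condition, applied to the elements of rist m c, makes S b a block
   for the action of that group. *)
Lemma star_eq_rist b m c : (exists2 x, O b x & halftree m c x) -> ~ O b m ->
  (forall j, exists2 l, l <> j & ~ S l `<=` rist m c) -> S b = rist m c.
Proof.
move=> [x Obx [mx mc]] nm big.
have Sb : S b `<=` rist m c.
  move=> s Ss; split; first exact: SG Ss.
  move=> y ny; apply: contrapT => sy; apply: ny; rewrite -mc.
  by apply: (star_convex nm Obx); exists s.
apply: (primitive_rist K T3 cB hG (star_regular hS b) Sb (star_nontrivial hS b)).
(* The other alternative of nesting would put all members but one inside [rist m c], against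
   [big]. *)
have key g : rist m c g -> exists j, conj_set g (S b) `<=` S j.
  move=> rg; have [//|[j hj]] := star_nested hS b (proj1 rg).
  have [l lj] := big j; case=> s Sls; have := hj _ lj s Sls.
  move=> /Sb rs; have rR := regular_rist (Gamma := Gamma) K T3 cB hG m c.
  have := regularM rR (regularM rR rg rs) (regularV rR rg).
  by rewrite /conjg !mulgA mulgV mul1g -mulgA mulgV mulg1.
(* [key] gives only an inclusion. Applied to the inverse of [g] as well, it yields equality when
   both members found are [S b], and independence otherwise. *)
move=> g rg; have [j hj] := key _ rg; have [l hl] := key _ (ristV hG rg).
have back d : S b d -> S l (d ^ g)%g.
  by move=> Sd; apply: hl; rewrite /conj_set /= -conjgM mulgV conjg1.
have [jb|jb] := pselect (j = b); last first.
  by right => d e Sd /hj Se; apply: (star_ind hS (nesym jb) Sd Se).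
have [lb|lb] := pselect (l = b).
  left; subst j l; apply/seteqP; split => // s Ss; exact: back.
right => d e Sd Se y.
have [h|h] := star_ind hS lb (back _ Sd) Se ((g^-1)%g y); [left|right];
  by move: h; rewrite /conjg !symM symKV; exact: sym_inj.
Qed.

End StarIsRist.

Lemma star_is_rist I (S : I -> set (Sym B)) :
  (exists a b c : I, [/\ a <> b, a <> c & b <> c]) -> star S ->
  exists m, exists2 f : I -> T, bijective f & forall i, S i = rist m (f i).
Proof.
move=> [a [b [c [ab ac bc]]]] hS.
pose O i : set B := [set x | exists2 s, S i s & s x <> x].
have Opt i : exists x, O i x.
  by have [s Ss /sym_neq1[x sx]] := star_nontrivial hS i; exists x, s.
have Odis i j x : i <> j -> O i x -> O j x -> False.
  by move=> ij [s Ss sx] [t St tx]; case: (star_ind hS ij Ss St x).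
have Orist i m l : S i `<=` rist m l -> forall x, O i x -> halftree m l x.
  by move=> h x [s /h rs sx]; exact: rist_support rs sx.
have [pa Oa] := Opt a; have [pb Ob] := Opt b; have [pc Oc] := Opt c.
have pab : pa <> pb by move=> e; subst pb; exact: Odis ab Oa Ob.
have pac : pa <> pc by move=> e; subst pc; exact: Odis ac Oa Oc.
have pbc : pb <> pc by move=> e; subst pc; exact: Odis bc Ob Oc.
(* Either one of the three points lies between the other two, or they have a median. The guards such
   as [m <> pa] accommodate the first case. *)
have [m [hab hac hbc]] : exists m, [/\
    m <> pa -> m <> pb -> k m pa <> k m pb,
    m <> pa -> m <> pc -> k m pa <> k m pc &
    m <> pb -> m <> pc -> k m pb <> k m pc].
  have [e1|n1] := pselect (k pa pb = k pa pc); last first.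
    by exists pa; split.
  have [e2|n2] := pselect (k pb pa = k pb pc); last first.
    by exists pb; split.
  have [e3|n3] := pselect (k pc pa = k pc pb); last first.
    by exists pc; split.
  have [|m [[? ? ?] [? ? ?]]] := kaleido_median K pab pac pbc; first by split.
  by exists m; split.
have one i x u v pu pv : O i x -> ~ O i m -> u <> v -> O u pu -> O v pv ->
    ~ halftree m (k m x) pu -> ~ halftree m (k m x) pv ->
    S i = rist m (k m x).
  move=> Oi nm uv Ou Ov nu nv; have mx : m <> x by move=> e; subst x.
  apply: (star_eq_rist hS); [by exists x|by []|] => j.
  have [uj|uj] := pselect (u = j); [exists v|exists u].
  - by rewrite -uj; exact: nesym.
  - by move=> /Orist /(_ _ Ov).
  - by [].
  - by move=> /Orist /(_ _ Ou).
(* [S j] is independent of [rist m l], which moves every point of its half-tree; so [S j] fixes that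
   half-tree and hence its root [m]. *)
have notO i j l : S i = rist m l -> i <> j -> ~ O j m.
  move=> e ij [s Ss sm]; apply: sm.
  have Gs : G s := regular_sub (star_regular hS j) Ss.
  apply: (@fix_root _ _ _ _ K m l s Gs) => y my.
  have [h rh hy] := rist_moves (Gamma := Gamma) K T3 cB hG my.
  by rewrite -e in rh; case: (star_ind hS ij rh Ss y).
have three u v w pu pv pw : u <> v -> u <> w -> v <> w ->
    O u pu -> O v pv -> O w pw ->
    (m <> pu -> m <> pv -> k m pu <> k m pv) ->
    (m <> pu -> m <> pw -> k m pu <> k m pw) ->
    (m <> pv -> m <> pw -> k m pv <> k m pw) ->
    ~ O u m -> S u = rist m (k m pu).
  move=> uv uw vw Ou Ov Ow h1 h2 h3 nm.
  have mu : m <> pu by move=> e; subst pu.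
  apply: (one u pu v w pv pw) => // -[mm e].
    by apply: (h1 mu mm); rewrite e.
  by apply: (h2 mu mm); rewrite e.
(* If the support of [S a] contained [m], that of [S b] would not; then [S b] would be a rigid
   stabilizer at [m], and [notO] would expel [m] from the support of [S a]. *)
have nOa : ~ O a m.
  move=> Om; have nb : ~ O b m by move=> Obm; exact: Odis ab Om Obm.
  have := three b a c pb pa pc (nesym ab) bc ac Ob Oa Oc
    (fun h1 h2 => nesym (hab h2 h1)) hbc hac nb.
  by move=> /notO /(_ (nesym ab)).
have nOb : ~ O b m.
  have := three a b c pa pb pc ab ac bc Oa Ob Oc hab hac hbc nOa.
  by move=> /notO /(_ ab).
have Sa := three a b c pa pb pc ab ac bc Oa Ob Oc hab hac hbc nOa.
have nO i : ~ O i m.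
  by have [<-//|ai] := pselect (a = i); exact: notO Sa ai.
have ma : m <> pa by move=> e; subst pa.
have mb : m <> pb by move=> e; apply: nOb; rewrite e.
have mc : m <> pc by move=> e; apply: (nO c); rewrite e.
have {}hab := hab ma mb; have {}hac := hac ma mc; have {}hbc := hbc mb mc.
have [p hp] := choice Opt.
have SE i : S i = rist m (k m (p i)).
  have [ea|na] := pselect (k m (p i) = k m pa).
    by apply: (one i (p i) b c pb pc) => // -[]; congruence.
  have [eb|nb] := pselect (k m (p i) = k m pb).
    by apply: (one i (p i) a c pa pc) => // -[]; congruence.
  by apply: (one i (p i) a b pa pb) => // -[]; congruence.
have finj i j : k m (p i) = k m (p j) -> i = j.
  move=> e; apply: contrapT => ij; apply: (Odis i j (p i)) => //.
  have := hp i; rewrite /O SE e => -[s rs sp]; exists s => //.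
  by rewrite SE.
(* A missing color would make [rist m l] independent of all members, against [star_total]. *)
have fsurj l : exists i, k m (p i) = l.
  apply: contrapT => n; have [g rg g1] := rist_nontrivial K T3 cB hG m l.
  apply: g1; apply: (star_total hS) => [|i s]; first by case: rg.
  by rewrite SE => rs; apply: (rist_disjoint _ rg rs) => e; apply: n; exists i.
have [q hq] := choice fsurj.
exists m, (fun i => k m (p i)) => //; exists q => [i|l] //.
by apply: finj; rewrite hq.
Qed.

End StarsAreHalftrees.

(** * Transport of stars along a group isomorphism *)

Record subgroup_iso (H H' : groupType) (A : set H) (A' : set H')
    (phi : H -> H') (psi : H' -> H) : Prop := SubgroupIso {
  iso_dom1 : A 1%g;
  iso_domM : forall g h, A g -> A h -> A (g * h)%g;
  iso_domV : forall g, A g -> A (g^-1)%g;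
  iso_img : forall g, A g -> A' (phi g);
  iso_img_inv : forall g, A' g -> A (psi g);
  isoK : forall g, A g -> psi (phi g) = g;
  isoVK : forall g, A' g -> phi (psi g) = g;
  isoM : forall g h, A g -> A h -> phi (g * h)%g = (phi g * phi h)%g
}.

Section Transfer.
Variables (H H' : groupType) (A : set H) (A' : set H').
Implicit Types (phi : H -> H') (psi : H' -> H).

Lemma iso1 phi psi : subgroup_iso A A' phi psi -> phi 1%g = 1%g.
Proof.
move=> I; have := isoM I (iso_dom1 I) (iso_dom1 I); rewrite mulg1 => e.
by apply: (mulgI (phi 1%g)); rewrite mulg1 -e.
Qed.

Lemma isoV phi psi g : subgroup_iso A A' phi psi -> A g ->
  phi (g^-1)%g = ((phi g)^-1)%g.
Proof.
move=> I Ag; apply: (mulgI (phi g)); rewrite mulgV -(isoM I) ?mulgV ?(iso1 I)//.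
exact: (iso_domV I).
Qed.

Lemma iso_sym phi psi : subgroup_iso A A' phi psi -> subgroup_iso A' A psi phi.
Proof.
move=> I; split.
- by rewrite -(iso1 I); exact: (iso_img I (iso_dom1 I)).
- move=> g h Ag Ah; have Bg := iso_img_inv I Ag; have Bh := iso_img_inv I Ah.
  rewrite -(isoVK I Ag) -(isoVK I Ah) -(isoM I)//.
  by apply: (iso_img I); exact: (iso_domM I).
- move=> g Ag; rewrite -(isoVK I Ag) -(isoV I); last exact: (iso_img_inv I).
  by apply: (iso_img I); apply: (iso_domV I); exact: (iso_img_inv I).
- exact: iso_img_inv I.
- exact: iso_img I.
- exact: isoVK I.
- exact: isoK I.
- move=> g h Ag Ah; have Bg := iso_img_inv I Ag; have Bh := iso_img_inv I Ah.
  by rewrite -{1}(isoVK I Ag) -{1}(isoVK I Ah) -(isoM I)// (isoK I)//; exact: (iso_domM I).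
Qed.

Lemma iso_domJ phi psi g h : subgroup_iso A A' phi psi -> A g -> A h ->
  A (g ^ h)%g.
Proof.
by move=> I Ag Ah; apply: (iso_domM I); [exact: (iso_domV I)|exact: (iso_domM I)].
Qed.

Lemma isoJ phi psi g h : subgroup_iso A A' phi psi -> A g -> A h ->
  phi (g ^ h)%g = (phi g ^ phi h)%g.
Proof.
move=> I Ag Ah; rewrite /conjg !(isoM I) ?(isoV I)//; by [exact: (iso_domV I)|exact: (iso_domM I)].
Qed.

Lemma iso_domR phi psi g h : subgroup_iso A A' phi psi -> A g -> A h ->
  A ([~ g, h])%g.
Proof.
by move=> I Ag Ah; apply: (iso_domM I); [exact: (iso_domV I)|exact: (iso_domJ I)].
Qed.

Lemma isoR phi psi g h : subgroup_iso A A' phi psi -> A g -> A h ->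
  phi ([~ g, h])%g = [~ phi g, phi h]%g.
Proof.
move=> I Ag Ah; rewrite !commgEl (isoM I) ?(isoV I) ?(isoJ I)//;
  by [exact: (iso_domV I)|exact: (iso_domJ I)].
Qed.

Lemma iso_domX phi psi g n : subgroup_iso A A' phi psi -> A g -> A (g ^+ n)%g.
Proof.
move=> I Ag; elim: n => [|n IH]; first exact: iso_dom1 I.
by rewrite expgS; exact: (iso_domM I).
Qed.

Lemma isoX phi psi g n : subgroup_iso A A' phi psi -> A g ->
  phi (g ^+ n)%g = (phi g ^+ n)%g.
Proof.
move=> I Ag; elim: n => [|n IH]; first by rewrite !expg0 (iso1 I).
by rewrite !expgS (isoM I) ?IH//; exact: iso_domX I _.
Qed.

End Transfer.

Section TransferDisjointness.
Variables (H H' : groupType) (A : set H) (A' : set H').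
Implicit Types (phi : H -> H') (psi : H' -> H).

Lemma iso_commute phi psi g h : subgroup_iso A A' phi psi -> A g -> A h ->
  commute (phi g) (phi h) <-> commute g h.
Proof.
move=> I Ag Ah; rewrite /commute -!(isoM I)//; split => [|-> //].
move=> /(congr1 psi); rewrite !(isoK I)//; exact: (iso_domM I).
Qed.

Lemma iso_neq1 phi psi g : subgroup_iso A A' phi psi -> A g ->
  g <> 1%g -> phi g <> 1%g.
Proof.
by move=> I Ag g1 e; apply: g1; rewrite -(isoK I Ag) e (iso1 (iso_sym I)).
Qed.

Lemma iso_algebraically_disjoint phi psi f g : subgroup_iso A A' phi psi ->
  A f -> A g -> algebraically_disjoint A f g ->
  algebraically_disjoint A' (phi f) (phi g).
Proof.
move=> I Af Ag ad h Ah nc; have Ah' := iso_img_inv I Ah.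
have [|f1 [f2 [[A1 A2 c1 c2] [n1 c]]]] := ad _ Ah'.
  by move/(iso_commute I Af Ah'); rewrite (isoVK I).
have AR : A [~ psi h, f1, f2]%g by do 2 apply: (iso_domR I) => //.
exists (phi f1), (phi f2); split.
  by split; [exact: (iso_img I)|exact: (iso_img I)|exact/(iso_commute I)|exact/(iso_commute I)].
rewrite -(isoVK I Ah) -!(isoR I)//; last exact: (iso_domR I).
by split; [exact: iso_neq1 I _ _|exact/(iso_commute I)].
Qed.

End TransferDisjointness.

Lemma iso_hull (H H' : groupType) (A : set H) (A' : set H') phi psi f h :
  subgroup_iso A A' phi psi -> A f -> hull A f h -> hull A' (phi f) (phi h).
Proof.
move=> I Af [Ah hh]; split; first exact: iso_img I _ Ah.
move=> g Ag ad; have Ag' := iso_img_inv I Ag.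
rewrite -(isoVK I Ag) -(isoX _ I)//; apply/(iso_commute I) => //.
  exact: iso_domX I _.
apply: hh => //; rewrite -(isoK I Af).
exact: (iso_algebraically_disjoint (iso_sym I) (iso_img I Af)).
Qed.

Lemma iso_independent (H H' : groupType) (A : set H) (A' : set H') phi psi f g :
  subgroup_iso A A' phi psi -> A f -> A g ->
  independent A f g -> independent A' (phi f) (phi g).
Proof.
move=> I Af Ag ind h hf hg; have J := iso_sym I.
have := iso_hull J (iso_img I Af) hf; have := iso_hull J (iso_img I Ag) hg.
rewrite !(isoK I)// => hg' hf'; have := ind _ hf' hg' => e.
by case: hf => Ah _; rewrite -(isoVK I Ah) e (iso1 I).
Qed.

Section StarTransfer.
Variables (H H' : groupType) (A : set H) (A' : set H').
Variables (phi : H -> H') (psi : H' -> H).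
Hypothesis I : subgroup_iso A A' phi psi.
Variables (ind : H -> H -> Prop) (ind' : H' -> H' -> Prop).
Hypothesis indE : forall f g, A f -> A g -> ind f g <-> ind' (phi f) (phi g).
Let J := iso_sym I.

(** For [S] inside [A], this is the image of [S] under [phi], written through the inverse [psi] to
    avoid an existential. *)
Definition push (S : set H) : set H' := [set g | A' g /\ S (psi g)].

Lemma indVE f g : A' f -> A' g -> ind (psi f) (psi g) <-> ind' f g.
Proof.
by move=> Af Ag; rewrite indE ?(isoVK I)//; exact: iso_img_inv I _ _.
Qed.

Lemma perp_push S : S `<=` A -> perp A' ind' (push S) = push (perp A ind S).
Proof.
move=> SA; apply/seteqP; split => g.
  move=> [Ag hg]; split=> //; split; first exact: iso_img_inv I _ Ag.
  move=> s Ss; have As := SA _ Ss.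
  rewrite -(isoK I As) indVE//; last exact: iso_img I _ As.
  by apply: hg; split; [exact: (iso_img I)|rewrite (isoK I)].
move=> [Ag [_ hg]]; split => // s [As Ss].
by rewrite -indVE//; apply: hg.
Qed.

Lemma perp_dom S : perp A ind S `<=` A.
Proof. by move=> g []. Qed.

Lemma regular_dom S : regular A ind S -> S `<=` A.
Proof. by move=> <-; exact: perp_dom. Qed.

Lemma regular_push S : regular A ind S -> regular A' ind' (push S).
Proof.
move=> rS; rewrite /regular perp_push; last exact: regular_dom.
by rewrite perp_push ?rS//; exact: perp_dom.
Qed.

Lemma conj_push g S : S `<=` A -> A' g ->
  conj_set g (push S) = push (conj_set (psi g) S).
Proof.
move=> SA Ag; apply/seteqP; split => h [Ah Sh].
  have Ah' : A' h.
    have := iso_domJ J Ah (iso_domV J Ag).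
    by rewrite -conjgM mulgV conjg1.
  by split => //; rewrite /conj_set /= -(isoJ J).
by split; [exact: (iso_domJ J)|rewrite (isoJ J)].
Qed.

Lemma push_sub S S' : S `<=` S' -> push S `<=` push S'.
Proof. by move=> h g [Ag /h]. Qed.

End StarTransfer.

Arguments push {H H'} A' psi S.

Lemma push_psi (H H' : groupType) (A : set H) (A' : set H') phi psi S :
  subgroup_iso A A' phi psi -> S `<=` A -> push A phi (push A' psi S) = S.
Proof.
move=> I SA; apply/seteqP; split => g.
  by move=> [Ag [_]]; rewrite (isoK I).
move=> Sg; have Ag := SA _ Sg.
by split => //; split; [exact: (iso_img I)|rewrite (isoK I)].
Qed.

Lemma star_push (H H' : groupType) (A : set H) (A' : set H') phi psi ind ind' 
    I (S : I -> set H) : subgroup_iso A A' phi psi ->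
  (forall f g, A f -> A g -> ind f g <-> ind' (phi f) (phi g)) ->
  star A ind S -> star A' ind' (fun i => push A' psi (S i)).
Proof.
move=> iso indE hS; have J := iso_sym iso.
have SA i : S i `<=` A := regular_dom (star_regular hS i).
have indE' f g : A' f -> A' g -> ind' f g <-> ind (psi f) (psi g).
  by move=> Af Ag; rewrite (indVE iso indE).
split.
- by move=> i; exact: (regular_push iso indE (star_regular hS i)).
- move=> i; have [s Ss s1] := star_nontrivial hS i; have As := SA _ _ Ss.
  exists (phi s); last exact: iso_neq1 iso As s1.
  by split; [exact: (iso_img iso)|rewrite (isoK iso)].
- move=> i j s t ij [As Ss] [At St]; rewrite indE'//.
  exact: (star_ind hS ij Ss St).
- move=> g Ag hg; rewrite -(isoVK iso Ag) (_ : psi g = 1%g) ?(iso1 iso)//.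
  apply: (star_total hS); first exact: iso_img_inv iso _ Ag.
  move=> i s Ss; have As := SA _ _ Ss; rewrite -(isoK iso As) -indE'//.
    by apply: (hg i); split; [exact: (iso_img iso)|rewrite (isoK iso)].
  exact: iso_img iso _ As.
- move=> g i Ag; rewrite (conj_push iso)//.
  have [[j hj]|[j hj]] := star_nested hS i (iso_img_inv iso Ag); [left|right]; exists j.
    exact: push_sub.
  by move=> l lj; apply: push_sub; exact: hj.
- move=> i D rD DS [d Dd d1] blk.
  have DA : D `<=` A' := regular_dom rD.
  rewrite -(push_psi J DA); congr push.
  apply: (star_primitive hS).
  + exact: (regular_push J indE' rD).
  + by move=> g [Ag /DS [_]]; rewrite (isoK iso).
  + have Ad := DA _ Dd; exists (psi d); last exact: iso_neq1 J Ad d1.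
    by split; [exact: (iso_img J)|rewrite (isoVK iso)].
  + move=> g Sg; have Ag := SA _ _ Sg; have Ag' := iso_img iso Ag.
    rewrite (conj_push J)//; have [|e|h] := blk (phi g).
    * by split => //; rewrite (isoK iso).
    * by left; rewrite e.
    * right => a b [Aa Da] [Ab Db]; rewrite indE//; exact: h.
Qed.

(** * Recovering the permutation group from a star *)

Lemma rist_inj (B T : choiceType) (k : B -> B -> T) (Gamma : set (Sym T)) x i y j :
  kaleido k -> (exists a b c : T, [/\ a <> b, a <> c & b <> c]) ->
  countable [set: B] -> group_closed [in Gamma] ->
  rist k Gamma x i = rist k Gamma y j -> x = y /\ i = j.
Proof.
move=> K T3 cB hG e.
have sub u l v c : rist k Gamma u l = rist k Gamma v c ->
    halftree k u l `<=` halftree k v c.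
  move=> e' z uz; have [g rg gz] := rist_moves (Gamma := Gamma) K T3 cB hG uz.
  by rewrite e' in rg; exact: rist_support rg gz.
have eh : halftree k x i = halftree k y j.
  by apply/seteqP; split; apply: sub.
have xy := halftree_root K eh; split => //; subst y.
have [z xz] := halftree_nonempty K x i; have := xz; rewrite eh => -[_ <-].
by case: xz.
Qed.

(** Permuting the colors at [m] can only spoil betweenness when the point found is [m] itself; a
    point with the same colors between [x] and [m] then replaces it. *)
Lemma kaleido_twist (B T : choiceType) (k : B -> B -> T) (s : Sym T) m :
  kaleido k -> (exists a b c : T, [/\ a <> b, a <> c & b <> c]) ->
  kaleido (fun x y => if x == m then (s^-1)%g (k x y) else k x y).
Proof.
move=> K T3.
have cancel_if x y z :
    ((if x == m then (s^-1)%g (k x y) else k x y) =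
     (if x == m then (s^-1)%g (k x z) else k x z)) <-> k x y = k x z.
  by case: eqP => // _; split => [e|-> //]; exact: sym_inj e.
split.
- move=> x y z xy xz; rewrite !cancel_if => n; exact: (kaleido_tree K).
- move=> x y i j xy ij; have [z [zx zy kzx kzy]] := kaleido_between K xy ij.
  have [zm|zm] := pselect (z = m); last first.
    by exists z; split => //; case: eqP.
  have [w [wx wz kwx kwz]] := kaleido_between K (nesym zx) ij.
  have wm : w <> m by rewrite -zm.
  case: (treeP K wx wz) => [|[_ _ kxw kzw]]; first by congruence.
  case: (treeP K (nesym wz) zy) => [|[_ wy kwy kyw]]; first by congruence.
  by exists w; split => //; case: eqP => // _; congruence.
- move=> x i; case: eqP => _; last exact: (kaleido_onto K).
  have [y [xy kxy]] := kaleido_onto K x (s i).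
  by exists y; split => //; rewrite kxy symVK.
- move=> x y z xy xz yz [/cancel_if e1 /cancel_if e2 /cancel_if e3].
  have [p [p1 [n1 n2 n3]]] := kaleido_median K xy xz yz (And3 e1 e2 e3).
  by exists p; split => //; split; rewrite cancel_if.
Qed.

(** An isomorphism from [k] to its twist at [m] that fixes [m] has local action [s] at [m] and
    trivial local action elsewhere. *)
Lemma kaleido_group_twist (B T : choiceType) (k : B -> B -> T)
    (Gamma : set (Sym T)) m s :
  kaleido k -> (exists a b c : T, [/\ a <> b, a <> c & b <> c]) ->
  countable [set: B] -> group_closed [in Gamma] -> Gamma s ->
  exists g, [/\ kaleido_group k Gamma g, g m = m &
    forall y, m <> y -> k m (g y) = s (k m y)].
Proof.
move=> K T3 cB hG Gs.
pose l x y := if x == m then (s^-1)%g (k x y) else k x y.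
have piso : partial_iso k l [:: (m, m)].
  split.
  - by move=> a a' b b'; rewrite !inE => /eqP[-> ->] /eqP[-> ->].
  - by move=> a a' b b'; rewrite !inE => /eqP[-> ->] /eqP[-> ->].
  - by move=> a a' b b' c c'; rewrite !inE => /eqP[-> _] /eqP[-> _].
have [h hl hm] := back_and_forth K (kaleido_twist s m K T3) T3 cB piso isT.
have hmm : h m = m by apply: hm; rewrite mem_head.
have hs y : m <> y -> k m (h y) = s (k m y).
  move=> my; have := hl _ _ my; rewrite hmm eqxx => <-.
  by rewrite symKV.
exists h; split => // x; have [xm|xm] := pselect (x = m).
  by exists s => // y; rewrite xm hmm; exact: hs.
exists 1%g; first exact: Gamma1.
move=> y xy; rewrite -[RHS]/(k x y) -(hl _ _ xy) /l; case: eqP => // hxm.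
by case: xm; apply: (@sym_inj _ h); rewrite hxm hmm.
Qed.

Theorem kaleido_group_iso (B T B' T' : choiceType) (k : B -> B -> T)
    (k' : B' -> B' -> T') (Gamma : set (Sym T)) (Gamma' : set (Sym T')) :
  kaleido k -> kaleido k' ->
  (exists a b c : T, [/\ a <> b, a <> c & b <> c]) ->
  (exists a b c : T', [/\ a <> b, a <> c & b <> c]) ->
  countable [set: B] -> countable [set: B'] -> [set: B] !=set0 ->
  group_closed [in Gamma] -> group_closed [in Gamma'] ->
  isomorphic_subgroups (kaleido_group k Gamma) (kaleido_group k' Gamma') ->
  permutation_isomorphic Gamma Gamma'.
Proof.
move=> K K' T3 T3' cB cB' [x _] hG hG' [phi [phiA phi_inj phi_surj] phiM].
have [psi psiP] : exists psi, forall g', kaleido_group k' Gamma' g' ->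
    kaleido_group k Gamma (psi g') /\ phi (psi g') = g'.
  have /choice : forall g', exists g, kaleido_group k' Gamma' g' ->
      kaleido_group k Gamma g /\ phi g = g'.
    move=> g'; have [/phi_surj[g Gg <-]|n] := pselect (kaleido_group k' Gamma' g').
      by exists g.
    by exists 1%g => /n.
  by move=> [psi hpsi]; exists psi.
have iso : subgroup_iso (kaleido_group k Gamma) (kaleido_group k' Gamma') phi psi.
  split.
  - exact: group1.
  - by move=> g h; exact: groupM.
  - by move=> g; exact: groupV.
  - exact: phiA.
  - by move=> g /psiP[].
  - move=> g Gg; have [h1 h2] := psiP _ (phiA _ Gg).
    by apply: phi_inj; rewrite ?inE.
  - by move=> g /psiP[].
  - by move=> g h Gg Gh; apply: phiM; rewrite inE.
have isoVr := iso_sym iso.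
have indE f g : kaleido_group k Gamma f -> kaleido_group k Gamma g ->
    disjoint_support f g <-> disjoint_support (phi f) (phi g).
  move=> Gf Gg; have Gf' := phiA _ Gf; have Gg' := phiA _ Gg.
  apply: (iff_trans (disjoint_supportP K T3 cB hG Gf Gg)).
  apply: iff_trans (iff_sym (disjoint_supportP K' T3' cB' hG' Gf' Gg')).
  split; first exact: iso_independent iso Gf Gg.
  move=> /(iso_independent isoVr Gf' Gg'); rewrite !(isoK iso)//.
have := star_push iso indE (star_rist K T3 cB hG x).
move=> /(star_is_rist K' T3' cB' hG' T3)[m [f bf hf]].
have fbij := bf; case: bf => fi fK fiK.
have conjE g i : kaleido_group k Gamma g ->
    push (kaleido_group k' Gamma') psi (conj_set g (rist k Gamma x i)) =
    conj_set (phi g) (rist k' Gamma' m (f i)).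
  move=> Gg; rewrite -hf (conj_push iso) ?(isoK iso)//; last exact: phiA.
  by move=> h [].
have pushI v i w j : push (kaleido_group k' Gamma') psi (rist k Gamma v i) =
    push (kaleido_group k' Gamma') psi (rist k Gamma w j) -> v = w /\ i = j.
  have ristG u l : rist k Gamma u l `<=` kaleido_group k Gamma by move=> h [].
  move=> /(congr1 (push (kaleido_group k Gamma) phi)).
  by rewrite !(push_psi iso)// => /(rist_inj K T3 cB hG).
exists f => //; apply/seteqP; split => [s' Gs'|t [s Gs e]].
- have [g' [Gg' g'm hg']] := kaleido_group_twist m K' T3' cB' hG' Gs'.
  have [Gg phig] := psiP _ Gg'; set g := psi g' in Gg phig.
  have [s Gs [_ hs]] := conj_rist hG x Gg.
  have [s1 _ [hk hs1]] := conj_rist hG' m Gg'.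
  exists s => //; apply/funext => i /=.
  have s1E : s1 (f i) = s' (f i).
    have [y [my <-]] := kaleido_onto K' m (f i).
    by rewrite -hk// g'm hg'.
  (* [g] is not known beforehand to fix [x]; injectivity of the labelling of rigid stabilizers gives
     this together with [f (s i) = s' (f i)]. *)
  have := conjE g i Gg; rewrite hs phig hs1 g'm s1E.
  by rewrite -[s' (f i)]fiK -hf => /pushI[_ ->].
- have [g [Gg gx hg]] := kaleido_group_twist x K T3 cB hG Gs.
  have [s1 _ [hk hs1]] := conj_rist hG x Gg.
  have [s' Gs' [_ hs']] := conj_rist hG' m (phiA _ Gg).
  suff -> : t = s' by [].
  apply: symP => j; rewrite -[j]fiK.
  have -> : t (f (fi j)) = f (s (fi j)) by exact: (congr1 (@^~ (fi j)) e).
  have s1E : s1 (fi j) = s (fi j).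
    have [y [xy <-]] := kaleido_onto K x (fi j).
    by rewrite -hk// gx hg.
  have := conjE g (fi j) Gg; rewrite hs1 hs' gx s1E hf.
  by move=> /(rist_inj K' T3' cB' hG')[].
Qed.

(** * Dendrites *)

Section Branches.
Local Open Scope ring_scope.
Variables (R : realType) (X : metricType R).
Hypothesis cX : connected [set: X].
Hypothesis lX : locally_connected X.
Implicit Types x y z p q : X.

Lemma closed_point x : closed [set x].
Proof. exact/accessible_closed_set1/hausdorff_accessible/metric_hausdorff. Qed.

Lemma branch_refl x y : x <> y -> branch x y y.
Proof. by move=> xy; apply: connected_component_refl => /= e; apply: xy. Qed.

Lemma branch_neq x y z : branch x y z -> x <> z.
Proof. by move=> /connected_component_sub /= h e; apply: h. Qed.

Lemma branch_connected x y : connected (branch x y).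
Proof. exact: component_connected. Qed.

Lemma branch_eq x y z : branch x y z -> branch x y = branch x z.
Proof. exact: same_connected_component. Qed.

Lemma branchE x y z : x <> z -> branch x y = branch x z -> branch x y z.
Proof. by move=> xz ->; exact: branch_refl. Qed.

Lemma connected_branch (V : set X) x y z :
  connected V -> ~ V x -> V y -> V z -> branch x y = branch x z.
Proof.
move=> cV Vx Vy Vz; apply: same_connected_component.
by apply: (connected_component_max Vy _ cV) => // t Vt /= e; apply: Vx; rewrite -e.
Qed.

Lemma connected_separator (V : set X) x y z :
  connected V -> V y -> V z -> branch x y <> branch x z -> V x.
Proof.
by move=> cV Vy Vz n; apply: contrapT => Vx; apply: n; exact: connected_branch cV Vx Vy Vz.
Qed.

Lemma branch_open x y : open (branch x y).
Proof.
rewrite openE => z xyz; have xz := branch_neq xyz.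
have : nbhs z (~` [set x]).
  apply: open_nbhs_nbhs; split; last by move=> /= e; apply: xz.
  by apply: closed_openC; exact: closed_point.
move=> /lX[V [oV Vz cV VX]]; rewrite /interior nbhsE; exists V => // t Vt.
rewrite (branch_eq xyz); apply: (connected_component_max Vz _ cV Vt) => //.
Qed.

Lemma branch_nbhs x y z : branch x y z -> nbhs z (branch x y).
Proof. by move=> h; apply: open_nbhs_nbhs; split => //; exact: branch_open. Qed.

Lemma closure_branch x y z : closure (branch x y) z -> x <> z -> branch x y z.
Proof.
move=> cz xz; have [t [xyt xzt]] := cz _ (branch_nbhs (branch_refl xz)).
by apply: branchE => //; rewrite (branch_eq xyt) (branch_eq xzt).
Qed.

Lemma closure_branch_root x y : x <> y -> closure (branch x y) x.
Proof.
move=> xy; apply: contrapT => n.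
have cl : closed (branch x y).
  move=> z cz; apply: closure_branch => // e; apply: n; by rewrite {2}e.
have e : branch x y = [set: X].
  apply: cX.
  - by exists y; exact: branch_refl.
  - by exists (branch x y); rewrite ?setTI//; exact: branch_open.
  - by exists (branch x y); rewrite ?setTI.
have : branch x y x by rewrite e.
by move/branch_neq.
Qed.


(** The branch of [z] at [x] together with [x] is the closure of that branch, hence connected, and
    it avoids [y]. *)
Lemma branch_tree x y z : x <> y -> x <> z -> branch x y <> branch x z ->
  branch y x = branch y z.
Proof.
move=> xy xz n; have xz' := closure_branch_root xz.
have cz : connected (x |` branch x z).
  have -> : x |` branch x z = closure (branch x z).
    apply/seteqP; split => [t [->//|/subset_closure//]|t ct].
    by have [->|xt] := pselect (t = x); [left|right; apply: closure_branch ct (nesym xt)].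
  exact: (connected_closure (@branch_connected x z)).
apply: (connected_branch cz); [|by left|by right; exact: branch_refl].
by move=> [//|/branch_eq e]; [exact/nesym|apply: n].
Qed.

End Branches.

Section Arcs.
Local Open Scope ring_scope.
Variables (R : realType) (X : metricType R).
Implicit Types (x y z p q : X) (f : R -> X).

Definition arc_param x y f :=
  [/\ {within `[0, 1], continuous f}, {in `[0, 1] &, injective f},
      f 0 = x & f 1 = y].

Lemma arc_inj x y f a b : arc_param x y f -> 0 <= a <= 1 -> 0 <= b <= 1 ->
  f a = f b -> a = b.
Proof. by move=> [_ fi _ _] ha hb; apply: fi; rewrite in_itv. Qed.

Lemma arc_connected x y f a b : arc_param x y f -> 0 <= a -> b <= 1 ->
  connected (f @` `[a, b]).
Proof.
move=> [fc _ _ _] a0 b1; apply: connected_continuous_connected.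
  exact: segment_connected.
apply: continuous_subspaceW fc => t /=; rewrite !in_itv /= => /andP[h1 h2].
by rewrite (le_trans a0 h1) (le_trans h2 b1).
Qed.

Lemma arc_mem f (a b t : R) : a <= t <= b -> (f @` `[a, b]) (f t).
Proof. by move=> h; exists t => //=; rewrite in_itv. Qed.

Lemma arc_param_rev x y f : arc_param x y f -> arc_param y x (fun t => f (1 - t)).
Proof.
move=> [fc fi f0 f1]; split.
- apply/subspace_continuousP => t ht.
  have ht' : [set` `[0, 1]] (1 - t) by move: ht; rewrite /= !in_itv /=; lra.
  move=> U hU; move: fc => /subspace_continuousP/(_ _ ht' _ hU).
  rewrite !nbhs_simpl /= /within /= => /nbhs_ballP[e /= e0 he].
  apply/nbhs_ballP; exists e => //= r; rewrite /ball /= => hr hr01; apply: he.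
    by rewrite /ball /= -opprB normrN (_ : _ - _ = t - r) //; ring.
  by move: hr01; rewrite /= !in_itv /=; lra.
- move=> a b; rewrite !in_itv /= => ha hb /fi; rewrite !in_itv /= => h.
  by have := h ltac:(lra) ltac:(lra); lra.
- by rewrite subr0.
- by rewrite subrr.
Qed.

Lemma arc_near_left x y f s (U : set X) a : arc_param x y f -> 0 <= a -> a < s <= 1 ->
  nbhs (f s) U -> exists2 t, a < t < s & forall r, t < r <= s -> U (f r).
Proof.
move=> [fc _ _ _] a0 /andP[as_ s1] hU.
have hs : [set` `[0, 1]] s by rewrite /= in_itv /=; lra.
move: fc => /subspace_continuousP/(_ _ hs _ hU); rewrite nbhs_simpl /=.
rewrite /within /= => /nbhs_ballP[e /= e0 he].
exists (Num.max ((a + s) / 2) (s - e / 2)).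
  by rewrite lt_max gt_max; apply/andP; split; [apply/orP; left|apply/andP; split]; lra.
move=> r; rewrite gt_max => /andP[/andP[h1 h2] h3]; apply: he.
  by rewrite /ball /= ger0_norm; lra.
by rewrite /= in_itv /=; lra.
Qed.

Lemma arc_near_right x y f s (U : set X) : arc_param x y f -> 0 <= s < 1 ->
  nbhs (f s) U -> exists2 t, s < t < 1 & forall r, s <= r < t -> U (f r).
Proof.
move=> /arc_param_rev hf hs hU.
have hU' : nbhs (f (1 - (1 - s))) U by rewrite subKr.
have [||t ht hr] := arc_near_left (a := 0) hf _ _ hU'; [by []|lra|].
exists (1 - t); first lra.
by move=> r h; have := hr (1 - r) ltac:(lra); rewrite subKr.
Qed.

End Arcs.

Lemma segment3 n : at_least_three n ->
  exists a b c : segment n, [/\ a <> b, a <> c & b <> c].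
Proof.
move=> hn; have h i : (i < 3)%N -> segment n i.
  by case: n hn => [k|] //= hk hi; exact: leq_trans hi hk.
pose s i (hi : (i < 3)%N) : segment n := SigSub (mem_set (h i hi)).
by exists (s 0%N isT), (s 1%N isT), (s 2%N isT); split; move/(congr1 val).
Qed.

Lemma segment_inj n n' (f : segment n -> segment n') : bijective f -> n = n'.
Proof.
move=> [g fK gK]; have e : segment n' #= segment n.
  pose F i : nat := if pselect (segment n i) is left h
    then val (f (SigSub (mem_set h))) else 0%N.
  have FE (i : segment n) : F (val i) = val (f i).
    rewrite /F; case: pselect => [h|]; last by case; exact: set_valP.
    by congr (val (f _)); apply: val_inj.
  have <- : F @` segment n = segment n'.
    apply/seteqP; split => [_ [i si <-]|j sj].
      by rewrite -[i]/(val (SigSub (mem_set si) : segment n)) FE; exact: set_valP.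
    pose j' : segment n' := SigSub (mem_set sj).
    by exists (val (g j')); [exact: set_valP|rewrite FE gK].
  apply: inj_card_eq => i j; rewrite !inE => si sj.
  rewrite -[i]/(val (SigSub (mem_set si) : segment n)).
  rewrite -[j]/(val (SigSub (mem_set sj) : segment n)) !FE => /val_inj.
  by move=> /(can_inj fK) ->.
case: n n' e {f g fK gK} => [k|] [k'|] //=.
- by move=> /card_eq_II ->.
- by move=> /eq_finite_set e; case: infinite_nat; rewrite e; exact: finite_II.
- by move=> /eq_finite_set e; case: infinite_nat; rewrite -e; exact: finite_II.
Qed.

(** * Separation by branch points *)

Section Separation.
Local Open Scope ring_scope.
Variables (R : realType) (X : metricType R) (n : option nat).
Hypotheses (hn : at_least_three n) (hX : wazewski_dendrite X n).
Variable c : X -> set X -> segment n.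
Hypothesis hc : kaleidoscopic c.
Implicit Types x y z p q : X.

Let cX : connected [set: X].
Proof. by case: hX => -[]. Qed.

Let lX : locally_connected X.
Proof. by case: hX => -[]. Qed.

Lemma branch_eq_neq x y z : x <> z -> branch x y = branch x z -> x <> y.
Proof.
move=> xz e xy; have := branch_refl xz; rewrite -e xy /branch.
by rewrite connected_component_out // => /(_ erefl).
Qed.

Lemma open_arcP x y z : open_arc x y z ->
  exists f t, [/\ arc_param x y f, 0 < t < 1 & f t = z].
Proof.
move=> [A [f [fc fi f0 f1 ->]]] [[t /=]]; rewrite in_itv /= => t01 <- nt.
exists f, t; split => //; have [t0 t1] := andP t01.
rewrite !lt_neqAle t0 t1 !andbT; apply/andP; split; apply/eqP => e; apply: nt.
  by left; rewrite -e f0.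
by right; rewrite e f1.
Qed.

Lemma branch_point_between x y : x <> y ->
  exists f t, [/\ arc_param x y f, 0 < t < 1 & Br (f t)].
Proof.
case: hX => _ _ _ h /h[z /open_arcP[f [t [hf ht <-]]] Bz].
by exists f, t.
Qed.

(** The kaleidoscopic condition gives a point at which [x] and [y] have different colors, hence lie
    in different branches. *)
Lemma branch_points_separated x y : Br x -> Br y -> x <> y ->
  exists z, [/\ Br z, z <> x, z <> y & branch z x <> branch z y].
Proof.
move=> Bx By xy; have [i [j [_ [ij _ _]]]] := segment3 hn.
have [z [/open_arcP[f [t [hf t01 ft]]] Bz e1 e2]] := proj2 hc _ _ Bx By xy _ _ ij.
have [_ _ f0 f1] := hf.
exists z; split => //; last by move=> e; apply: ij; rewrite -e1 -e2 e.
- by rewrite -ft -f0 => /(arc_inj hf) h; have := h ltac:(lra) ltac:(lra); lra.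
- by rewrite -ft -f1 => /(arc_inj hf) h; have := h ltac:(lra) ltac:(lra); lra.
Qed.

(** Separating [x] from [f t], [w] lies on the initial part of the arc, so the rest of the arc
    avoids it. *)
Lemma arc_cut x y f t w : arc_param x y f -> 0 < t < 1 -> w <> f t ->
  branch w x <> branch w (f t) -> branch w (f t) = branch w y.
Proof.
move=> hf t01 wt nw; have [_ _ f0 f1] := hf.
have : (f @` `[0, t]) w.
  apply: (connected_separator _ _ _ nw).
  - by apply: (arc_connected hf); lra.
  - by rewrite -f0; apply: arc_mem; lra.
  - by apply: arc_mem; lra.
move=> [a /=]; rewrite in_itv /= => ha aw.
apply: (@connected_branch _ _ (f @` `[t, 1])).
- by apply: (arc_connected hf); lra.
- move=> [b /=]; rewrite in_itv /= -aw => hb /(arc_inj hf) h.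
  have e := h ltac:(lra) ltac:(lra).
  by apply: wt; rewrite -aw; congr f; lra.
- by apply: arc_mem; lra.
- by rewrite -f1; apply: arc_mem; lra.
Qed.

(* Distinct points are separated by a branch point: take a branch point z1
   between p and q, then z0 between p and z1, then w separating z0 and z1. *)
Lemma Br_separated p q : p <> q ->
  exists w, [/\ Br w, w <> p, w <> q & branch w p <> branch w q].
Proof.
move=> pq; have [g [s [hg s01 B1]]] := branch_point_between pq.
have [_ _ g0 g1] := hg.
have pz1 : p <> g s.
  by rewrite -{1}g0 => /(arc_inj hg) h; have := h ltac:(lra) ltac:(lra); lra.
have [f [t [hf t01 B0]]] := branch_point_between pz1.
have [_ _ f0 f1] := hf.
have z01 : f t <> g s.
  by rewrite -f1 => /(arc_inj hf) h; have := h ltac:(lra) ltac:(lra); lra.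
have [w [Bw w0 w1 n0]] := branch_points_separated B0 B1 z01.
have e1 : branch w p = branch w (f t).
  apply: contrapT => n'; apply: n0; exact: arc_cut hf t01 w0 n'.
have n1 : branch w p <> branch w (g s) by rewrite e1.
have e2 := arc_cut hg s01 w1 n1.
exists w; split => //; last by rewrite -e2.
- exact: branch_eq_neq w0 e1.
- exact: branch_eq_neq w1 (esym e2).
Qed.

Lemma branch_has_Br x y : x <> y -> exists2 z, Br z & branch x y z.
Proof.
move=> xy; have [w [Bw wx wy nw]] := Br_separated xy.
exists w => //; apply: branchE; first exact: nesym.
exact/esym/(branch_tree cX lX wx wy nw).
Qed.

(** A connected neighborhood with a second point contains a branch point separating the two; without
    one it would be open and closed, hence the whole space. *)
Lemma Br_dense p (U : set X) : nbhs p U -> exists2 z, Br z & U z.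
Proof.
move=> /lX[V [oV Vp cV VU]].
have [[q Vq pq]|n1] := pselect (exists2 q, V q & p <> q).
  have [w [Bw wp wq nw]] := Br_separated pq.
  by exists w => //; apply: VU; exact: (connected_separator cV Vp Vq nw).
have V1 : V = [set p].
  apply/seteqP; split => [q Vq|_ ->//].
  by apply: contrapT => /= e; apply: n1; exists q => //; exact: nesym.
have V2 : V = [set: X].
  apply: cX.
  - by exists p.
  - by exists V; rewrite ?setTI.
  - by exists V; rewrite ?setTI// V1; exact: closed_point.
case: hX => _ [x [y xy]] _ _.
have : [set: X] x by []. have : [set: X] y by [].
by rewrite -V2 V1 /= => e1 e2; case: xy; rewrite e1 e2.
Qed.

(* Let A be the union of the branches at w containing x, for w on the arc before
   u = f s and separating x from u: it is open, contains x but not y, and its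
   closure adds at most u, so that A cannot meet the branch of y at u. *)
Lemma arc_separates x y f s : arc_param x y f -> 0 < s < 1 ->
  branch (f s) x <> branch (f s) y.
Proof.
move=> hf s01 eV; have [fc _ f0 f1] := hf; set u := f s in eV *.
pose W := [set r : R | 0 < r < s /\ branch (f r) x <> branch (f r) u].
have neq a b : 0 <= a <= 1 -> 0 <= b <= 1 -> a != b -> f a <> f b.
  by move=> ha hb ab /(arc_inj hf) h; move/eqP: ab; apply; exact: h.
(* A branch point separating [f t] from [u] lies on the arc between them. *)
have cofinal t : 0 <= t < s -> exists2 r, t < r < s & W r.
  move=> ht; have tu : f t <> u by apply: neq; [lra|lra|apply/eqP; lra].
  have [w [_ wt wu nw]] := Br_separated tu.
  have : (f @` `[t, s]) w.
    apply: (connected_separator _ _ _ nw).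
    - by apply: (arc_connected hf); lra.
    - by apply: arc_mem; lra.
    - by apply: arc_mem; lra.
  move=> [r /=]; rewrite in_itv /= => hr rw.
  have rt : r != t by apply/eqP => e; apply: wt; rewrite -rw e.
  have rs : r != s by apply/eqP => e; apply: wu; rewrite -rw e.
  have ht2 : t < r < s by rewrite !lt_neqAle rs (eq_sym t) rt.
  exists r => //; split; first lra.
  have -> : branch (f r) x = branch (f r) (f t); last by rewrite rw.
  apply: (@connected_branch _ _ (f @` `[0, t])).
  - by apply: (arc_connected hf); lra.
  - by move=> [b /=]; rewrite in_itv /= => hb; apply: neq; [lra|lra|apply/eqP; lra].
  - by rewrite -f0; apply: arc_mem; lra.
  - by apply: arc_mem; lra.
pose A := \bigcup_(r in W) branch (f r) x.
have mono r r' : W r -> W r' -> r < r' -> branch (f r) x `<=` branch (f r') x.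
  move=> [hr nr] [hr' nr'] rr'.
  have xr : f r <> x by rewrite -f0; apply: neq; [lra|lra|apply/eqP; lra].
  apply: (connected_component_max (branch_refl xr)); last exact: branch_connected.
  move=> t brt /= e; apply: nr; rewrite (branch_eq brt) e.
  apply: (@connected_branch _ _ (f @` `[r', s])).
  - by apply: (arc_connected hf); lra.
  - by move=> [b /=]; rewrite in_itv /= => hb; apply: neq; [lra|lra|apply/eqP; lra].
  - by apply: arc_mem; lra.
  - by apply: arc_mem; lra.
have nAu : ~ A u by move=> [r [_ nr] /branch_eq].
have nAy : ~ A y.
  move=> [r [hr nr] /branch_eq e]; apply: nr; rewrite e.
  apply: (@connected_branch _ _ (f @` `[s, 1])).
  - by apply: (arc_connected hf); lra.
  - by move=> [b /=]; rewrite in_itv /= => hb; apply: neq; [lra|lra|apply/eqP; lra].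
  - by rewrite -f1; apply: arc_mem; lra.
  - by apply: arc_mem; lra.
have [r0 hr0 Wr0] := cofinal 0 ltac:(lra).
have Ax : A x.
  exists r0 => //; apply: branch_refl; rewrite -f0.
  by apply: neq; [lra|lra|apply/eqP; lra].
(* Otherwise some [v] separates [p] from [u]. Once a branch in the union meets the branch of [p] at
   [v], the later points [f r'] with [W r'] all lie in the latter, and so does their limit [u]. *)
have clA p : closure A p -> p <> u -> A p.
  move=> cp pu; apply: contrapT => nAp.
  have [v [_ vp vu nv]] := Br_separated pu.
  have [q [[r Wr brq] Nq]] := cp _ (branch_nbhs lX (branch_refl vp)).
  have inN r' : W r' -> r < r' -> branch v p (f r').
    move=> Wr' rr'; have := mono _ _ Wr Wr' rr' _ brq => brq'.
    apply: contrapT => nN; apply: nAp; exists r' => //.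
    rewrite (branch_eq brq'); apply: branchE.
      by move=> e; apply: nN; rewrite e; exact: branch_refl.
    by apply: (connected_branch _ nN) => //; [exact: branch_connected|exact: branch_refl].
  have : closure (branch v p) u.
    move=> U nU; have [||t ht hU] := arc_near_left (a := r) hf _ _ nU.
    - by case: Wr; lra.
    - by case: Wr; lra.
    have [r' hr' Wr'] := cofinal t ltac:(case: Wr; lra).
    exists (f r'); split; first by apply: inN => //; lra.
    by apply: hU; lra.
  by move=> /(closure_branch lX) /(_ vu) /branch_eq.
have oA : open A by apply: bigcup_open => r _; exact: branch_open.
have xu : u <> x by rewrite -f0; apply: neq; [lra|lra|apply/eqP; lra].
have yu : u <> y by rewrite -f1; apply: neq; [lra|lra|apply/eqP; lra].
(* [A] is open, and closed up to [u], so it contains the whole connected set [branch u x], to which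
   [y] would belong. *)
have e : branch u x `&` A = branch u x.
  apply: (@branch_connected _ _ u x).
  - by exists x; split => //; exact: branch_refl.
  - by exists A.
  - exists (closure A); first exact: closed_closure.
    apply/seteqP; split => p [h1 h2]; split => //; first exact: subset_closure.
    by apply: clA => // e; apply: (branch_neq h1).
apply: nAy; have : branch u x y by rewrite eV; exact: branch_refl.
by rewrite -e => -[].
Qed.

End Separation.

(** * Branch points and medians *)

Lemma card_ge3P (T : pointedType) (A : set T) :
  `I_3 #<= A <-> exists a b c, [/\ A a, A b & A c] /\ [/\ a <> b, a <> c & b <> c].
Proof.
split=> [/pcard_leP[f]|[a [b [c [[Aa Ab Ac] [ab ac bc]]]]]].
  exists (f 0%N), (f 1%N), (f 2%N); split; first by split; exact: funS.
  have fi i j : (i < 3)%N -> (j < 3)%N -> f i = f j -> i = j.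
    by move=> hi hj; apply: (@inj _ _ _ f); rewrite inE.
  by split; [move=> /(fi 0%N 1%N isT isT)|move=> /(fi 0%N 2%N isT isT)|
    move=> /(fi 1%N 2%N isT isT)].
have h3 : `I_3 #= [set a; b; c].
  pose F k := if k is 0%N then a else if k is 1%N then b else c.
  rewrite card_eq_sym (_ : [set a; b; c] = F @` `I_3).
    apply: inj_card_eq => i j; rewrite !inE.
    by case: i => [|[|[|]]] //; case: j => [|[|[|]]] // _ _ /= e; congruence.
  apply/seteqP; split => [t [[->|->]|->]|_ [k _ <-]].
  - by exists 0%N.
  - by exists 1%N.
  - by exists 2%N.
  - by case: k => [|[|k]] /=; [left; left|left; right|right].
rewrite (card_le_eql h3); apply: subset_card_le.
by move=> t [[->|->]|->].
Qed.

Section Medians.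
Local Open Scope ring_scope.
Variables (R : realType) (X : metricType R) (n : option nat).
Hypotheses (hn : at_least_three n) (hX : wazewski_dendrite X n).
Variable c : X -> set X -> segment n.
Hypothesis hc : kaleidoscopic c.
Implicit Types x y z p q : X.

Let cX : connected [set: X].
Proof. by case: hX => -[]. Qed.

Let lX : locally_connected X.
Proof. by case: hX => -[]. Qed.

Lemma BrP x : Br x <-> exists p q r, [/\ x <> p, x <> q & x <> r] /\
  [/\ branch x p <> branch x q, branch x p <> branch x r &
      branch x q <> branch x r].
Proof.
rewrite /Br /= card_ge3P; split.
  move=> [_ [_ [_ [[[p xp <-] [q xq <-] [r xr <-]] h]]]].
  by exists p, q, r; split => //; split; apply: nesym.
move=> [p [q [r [[xp xq xr] h]]]].
exists (branch x p), (branch x q), (branch x r); split => //.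
by split; [exists p|exists q|exists r] => //; exact: nesym.
Qed.

Lemma exists_arc x y : x <> y -> exists f : R -> X, arc_param x y f.
Proof. by move=> /(branch_point_between hX)[f [t [hf _ _]]]; exists f. Qed.

(* Otherwise an arc from z to y avoiding m, together with V, would join m to y;
   it would then contain all points of the arc f close to m = f s, hence m. *)
Lemma hit_separates (V : set X) f x y z s : arc_param x y f -> 0 <= s < 1 ->
  connected V -> V z -> V (f s) ->
  (forall t, 0 <= t <= 1 -> V (f t) -> f t = f s) ->
  z <> f s -> z <> y -> branch (f s) z <> branch (f s) y.
Proof.
move=> hf hs cV Vz Vm VF zm zy e; have [fc _ f0 f1] := hf.
have [g hg] := exists_arc zy; have [_ _ g0 g1] := hg.
have my : f s <> y.
  by rewrite -f1 => /(arc_inj hf) h; have := h ltac:(lra) ltac:(lra); lra.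
pose G := g @` `[0, 1].
have cG : connected G by apply: (arc_connected hg).
have Gz : G z by rewrite -g0; apply: arc_mem; lra.
have Gy : G y by rewrite -g1; apply: arc_mem; lra.
have nGm : ~ G (f s).
  move=> [r /=]; rewrite in_itv /= => hr rm.
  have r0 : r != 0 by apply/eqP => r0; apply: zm; rewrite -rm r0 g0.
  have r1 : r != 1 by apply/eqP => r1; apply: my; rewrite -rm r1 g1.
  have := @arc_separates _ _ _ hn hX _ hc _ _ _ r hg; rewrite rm; apply => //.
  by rewrite !lt_neqAle r1 eq_sym r0 /=; lra.
have GF r : s < r < 1 -> G (f r).
  move=> hr; have := @arc_separates _ _ _ hn hX _ hc _ _ _ r hf ltac:(lra) => sep.
  have e2 : branch (f r) x = branch (f r) (f s).
    apply: (@connected_branch _ _ (f @` `[0, s])).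
    - by apply: (arc_connected hf); lra.
    - move=> [b /=]; rewrite in_itv /= => hb /(arc_inj hf) h.
      by have := h ltac:(lra) ltac:(lra); lra.
    - by rewrite -f0; apply: arc_mem; lra.
    - by apply: arc_mem; lra.
  rewrite e2 in sep.
  have cVG : connected (V `|` G) by apply: connectedU => //; exists z.
  have [Vr|//] := connected_separator cVG (or_introl Vm) (or_intror Gy) sep.
  have := VF r ltac:(lra) Vr => /(arc_inj hf) h.
  by have := h ltac:(lra) ltac:(lra); lra.
have clG : closed G.
  apply: compact_closed; first exact: metric_hausdorff.
  by apply: continuous_compact; [case: hg|exact: segment_compact].
apply: nGm; apply: clG => U nU.
have [t ht hU] := arc_near_right hf hs nU.
exists (f ((s + t) / 2)); split; first by apply: GF; lra.
by apply: hU; lra.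
Qed.

Lemma first_hit z x h (F : set X) : arc_param z x h -> closed F -> F x ->
  exists2 t, 0 <= t <= 1 & F (h t) /\ forall r, 0 <= r < t -> ~ F (h r).
Proof.
move=> hh cF Fx; have [_ _ h0 h1] := hh.
pose T := [set t : R | 0 <= t <= 1 /\ F (h t)].
have T1 : T 1 by split; [lra|rewrite h1].
have lbT : lbound T 0 by move=> t [/andP[]].
have iT : has_inf T by split; [exists 1|exists 0].
have t0 : 0 <= inf T by apply: lb_le_inf => //; exists 1.
have t1 : inf T <= 1 by apply: ge_inf => //; case: iT.
have below r : 0 <= r < inf T -> ~ F (h r).
  move=> hr Fr; have : inf T <= r by apply: ge_inf; [case: iT|split => //; lra].
  by lra.
exists (inf T); first by rewrite t0.
split => //; apply: contrapT => nF.
have [e|ne] := eqVneq (inf T) 1; first by apply: nF; rewrite e h1.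
have lt1 : 0 <= inf T < 1 by rewrite t0 lt_neqAle ne.
have nU : nbhs (h (inf T)) (~` F).
  by apply: open_nbhs_nbhs; split => //; exact: closed_openC.
have [t ht hU] := arc_near_right hh lt1 nU.
have [r [hr Fr] rt] := inf_lt (proj1 iT) (proj1 (andP ht)).
by apply: (hU r) => //; rewrite rt andbT; apply: ge_inf => //; case: iT.
Qed.

(** The median is the first point of the arc from [z] to [x] on the arc from [x] to [y]. Applied to
    the latter arc and to its reverse, [hit_separates] separates [z] from [y] and from [x]. *)
Lemma branch_median x y z : x <> y -> x <> z -> y <> z ->
  branch x y = branch x z -> branch y x = branch y z -> branch z x = branch z y ->
  exists m, [/\ m <> x, m <> y & m <> z] /\
    [/\ branch m x <> branch m y, branch m x <> branch m z &
        branch m y <> branch m z].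
Proof.
move=> xy xz yz bx by_ bz.
have [f hf] := exists_arc xy; have [fc _ f0 f1] := hf.
have [h hh] := exists_arc (nesym xz); have [_ _ h0 h1] := hh.
pose F := f @` `[0, 1].
have clF : closed F.
  apply: compact_closed; first exact: metric_hausdorff.
  by apply: continuous_compact; [case: hf|exact: segment_compact].
have Fx : F x by rewrite -f0; apply: arc_mem; lra.
have [t ht [[s /= hs fs] hit]] := first_hit hh clF Fx.
rewrite in_itv /= in hs.
have nFz : ~ F z.
  move=> [r /=]; rewrite in_itv /= => hr rz.
  have r0 : r != 0 by apply/eqP => r0; apply: xz; rewrite -rz r0 f0.
  have r1 : r != 1 by apply/eqP => r1; apply: yz; rewrite -rz r1 f1.
  have := @arc_separates _ _ _ hn hX _ hc _ _ _ r hf; rewrite rz; apply => //.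
  by rewrite !lt_neqAle r1 eq_sym r0 /=; lra.
have zm : z <> f s by move=> e; apply: nFz; rewrite e; exact: arc_mem.
pose V := h @` `[0, t].
have cV : connected V by apply: (arc_connected hh); lra.
have Vz : V z by rewrite -h0; apply: arc_mem; lra.
have Vm : V (f s) by rewrite fs; apply: arc_mem; lra.
have VF r : 0 <= r <= 1 -> V (f r) -> f r = f s.
  move=> hr [b /=]; rewrite in_itv /= => hb e.
  have [bt|bt] := eqVneq b t; first by rewrite fs -bt.
  have lt : 0 <= b < t by rewrite lt_neqAle bt.
  by case: (hit b lt); rewrite e; exact: arc_mem.
have sy : s != 1 -> branch (f s) z <> branch (f s) y.
  move=> s1; apply: (hit_separates hf _ cV) => //; last exact: nesym.
  by rewrite lt_neqAle s1.
have sx : s != 0 -> branch (f s) z <> branch (f s) x.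
  move=> s0; have := @hit_separates V _ _ _ z (1 - s) (arc_param_rev hf).
  rewrite subKr; apply => //; last exact: nesym.
  - by rewrite subr_ge0 ltrBlDr ltrDl lt_neqAle eq_sym s0; lra.
  - by move=> r hr Vr; apply: VF => //; lra.
(* At an end of the arc, the point would be [y] or [x], which by hypothesis does not separate the
   other two. *)
have s1 : s != 1 by apply/eqP => e; apply: sx; rewrite e ?oner_eq0// f1.
have s0 : s != 0 by apply/eqP => e; apply: sy; rewrite e ?(eq_sym 0) ?oner_eq0// f0.
have hs' : 0 < s < 1 by rewrite !lt_neqAle s1 (eq_sym 0) s0.
exists (f s); split; split.
- by rewrite -f0 => /(arc_inj hf) e; have := e ltac:(lra) ltac:(lra); lra.
- by rewrite -f1 => /(arc_inj hf) e; have := e ltac:(lra) ltac:(lra); lra.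
- exact: nesym.
- exact: (arc_separates hn hX hc hf).
- by apply: nesym; exact: sx.
- by apply: nesym; exact: sy.
Qed.

End Medians.

(** * Branch points of a kaleidoscopic dendrite *)

Section Colors.
Local Open Scope ring_scope.
Variables (R : realType) (X : metricType R) (n : option nat).
Hypotheses (hn : at_least_three n) (hX : wazewski_dendrite X n).
Variable c : X -> set X -> segment n.
Hypothesis hc : kaleidoscopic c.
Implicit Types x y z p q : X.

Let cX : connected [set: X].
Proof. by case: hX => -[]. Qed.

Let lX : locally_connected X.
Proof. by case: hX => -[]. Qed.

Notation B := (set_type (@Br R X)).

Definition color (x y : B) : segment n := c (val x) (branch (val x) (val y)).

Lemma val_neq (x y : B) : x <> y -> val x <> val y.
Proof. by move=> xy /val_inj. Qed.

Lemma branches_branch x y : x <> y -> branches x (branch x y).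
Proof. by move=> xy; exists y => //; exact: nesym. Qed.

Lemma color_eq (x : B) p q : val x <> p -> val x <> q ->
  c (val x) (branch (val x) p) = c (val x) (branch (val x) q) <->
  branch (val x) p = branch (val x) q.
Proof.
move=> xp xq; split=> [|-> //]; have [_ ci _] := proj1 hc _ (set_valP x).
by apply: ci; rewrite inE; exact: branches_branch.
Qed.

Lemma colorE (x y z : B) : x <> y -> x <> z ->
  color x y = color x z <-> branch (val x) (val y) = branch (val x) (val z).
Proof. by move=> xy xz; apply: color_eq; exact: val_neq. Qed.

Lemma color_onto (x : B) p : val x <> p ->
  exists2 y : B, x <> y & branch (val x) (val y) = branch (val x) p.
Proof.
move=> xp; have [y By pxy] := branch_has_Br hn hX hc xp.
exists (SigSub (mem_set By)) => [e|]; last exact/esym/branch_eq.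
by apply: (branch_neq pxy); rewrite e.
Qed.

Lemma kaleido_color : kaleido color.
Proof.
split.
- move=> x y z xy xz nxyz; have yz : y <> z by congruence.
  apply/colorE; [exact: nesym|exact: yz|].
  by apply: (branch_tree cX lX); [exact: val_neq|exact: val_neq|move/colorE => /(_ xy xz)].
- move=> x y i j xy ij.
  have [z [/open_arcP[f [t [hf t01 ft]]] Bz e1 e2]] :=
    proj2 hc _ _ (set_valP x) (set_valP y) (val_neq xy) _ _ ij.
  have [_ _ f0 f1] := hf.
  exists (SigSub (mem_set Bz)); split => //.
  + move/(congr1 val) => /=; rewrite -ft -f0 => /(arc_inj hf) h.
    by have := h ltac:(lra) ltac:(lra); lra.
  + move/(congr1 val) => /=; rewrite -ft -f1 => /(arc_inj hf) h.
    by have := h ltac:(lra) ltac:(lra); lra.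
- move=> x i; have [_ _ cs] := proj1 hc _ (set_valP x).
  have [_ [p xp <-] <-] := cs i I.
  have xp' : val x <> p by exact: nesym.
  have [y xy e] := color_onto xp'; exists y; split => //.
  by rewrite /color e.
- move=> x y z xy xz yz [/colorE e1 /colorE e2 /colorE e3].
  have [|||m [[mx my mz] [mxy mxz myz]]] := branch_median hn hX hc
    (val_neq xy) (val_neq xz) (val_neq yz).
  + exact: e1.
  + by apply: e2 => //; exact: nesym.
  + by apply: e3; exact: nesym.
  have Bm : Br m by apply/BrP; exists (val x), (val y), (val z).
  pose m' : B := SigSub (mem_set Bm).
  have nx : m' <> x by move=> e; apply: mx; rewrite -e.
  have ny : m' <> y by move=> e; apply: my; rewrite -e.
  have nz : m' <> z by move=> e; apply: mz; rewrite -e.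
  by exists m'; split; split => //; move/colorE;
    [move=> /(_ nx ny)|move=> /(_ nx nz)|move=> /(_ ny nz)].
Qed.

Lemma Br_type_nonempty : [set: B] !=set0.
Proof.
case: hX => _ [x _] _ _.
have [z Bz _] := Br_dense hn hX hc (filterT : nbhs x setT).
by exists (SigSub (mem_set Bz)).
Qed.

(* A branch point is the median of any three points taken in three distinct
   branches at it, and these can be told apart by basic open sets. *)
Lemma Br_type_countable : countable [set: B].
Proof.
have kX : compact [set: X] by case: hX => -[].
have [x0 _] : [set: X] !=set0 by case: hX => -[].
pose XP : pseudoPMetricType R := HB.pack (Metric.sort X) (isPointed.Build X x0).
have [D /countable_injP[g gi] [Dop Dnb]] := @compact_second_countable R XP kX.
have small p (U : set X) : nbhs p U -> exists V, [/\ D V, V p & V `<=` U].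
  by move=> /Dnb[V [DV Vp] VU]; exists V.
have /choice[F hF] : forall x : B, exists UVW : set X * set X * set X,
    let: (U, V, W) := UVW in [/\ D U, D V & D W] /\
    exists p q r, [/\ U p, V q & W r] /\
    [/\ branch (val x) p <> branch (val x) q,
        branch (val x) p <> branch (val x) r &
        branch (val x) q <> branch (val x) r] /\
    [/\ U `<=` branch (val x) p, V `<=` branch (val x) q &
        W `<=` branch (val x) r].
  move=> x; have /BrP[p [q [r [[xp xq xr] h]]]] := set_valP x.
  have [U [DU Up Us]] := small _ _ (branch_nbhs lX (branch_refl xp)).
  have [V [DV Vp Vs]] := small _ _ (branch_nbhs lX (branch_refl xq)).
  have [W [DW Wp Ws]] := small _ _ (branch_nbhs lX (branch_refl xr)).
  by exists (U, V, W); split => //; exists p, q, r.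
apply/countable_injP.
exists (fun x : B => pickle (g (F x).1.1, g (F x).1.2, g (F x).2)).
move=> x y _ _ /(pcan_inj pickleK)[].
have := hF x; have := hF y; case: (F x) => -[U V] W; case: (F y) => -[U' V'] W'.
move=> /= [[DU' DV' DW'] [p' [q' [r' [[Up' Vq' Wr'] [[pq' pr' qr'] [Us' Vs' Ws']]]]]]].
move=> [[DU DV DW] [p [q [r [[Up Vq Wr] [[pq pr qr] [Us Vs Ws]]]]]]] e1 e2 e3.
have {e1 DU'} eU : U = U' by apply: gi; rewrite ?inE.
have {e2 DV'} eV : V = V' by apply: gi; rewrite ?inE.
have {e3 DW'} eW : W = W' by apply: gi; rewrite ?inE.
subst U' V' W'; apply: contrapT => /val_neq xy.
have xp := branch_neq (Us _ Up); have xq := branch_neq (Vs _ Vq).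
have xr := branch_neq (Ws _ Wr).
have yp := branch_neq (Us' _ Up); have yq := branch_neq (Vs' _ Vq).
have yr := branch_neq (Ws' _ Wr).
have epp := branch_eq (Us' _ Up); have eqq := branch_eq (Vs' _ Vq).
have err := branch_eq (Ws' _ Wr).
rewrite epp eqq err in pq' pr' qr'.
(* At most one of [p], [q], [r] is in the branch of [y] at [x]; the two others fall into the same
   branch at [y], that of [x], although [y] separates them. *)
have side u : val y <> u -> branch (val x) u <> branch (val x) (val y) ->
    branch (val y) u = branch (val y) (val x).
  move=> yu nu; have [e|xu] := pselect (val x = u); first by rewrite e.
  by apply/esym; exact: (branch_tree cX lX xy xu (nesym nu)).
have [e|np] := pselect (branch (val x) p = branch (val x) (val y)).
  have nq : branch (val x) q <> branch (val x) (val y) by rewrite -e; exact: nesym.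
  have nr : branch (val x) r <> branch (val x) (val y) by rewrite -e; exact: nesym.
  by apply: qr'; rewrite (side q yq nq) (side r yr nr).
have [e|nq] := pselect (branch (val x) q = branch (val x) (val y)).
  have nr : branch (val x) r <> branch (val x) (val y) by rewrite -e; exact: nesym.
  by apply: pr'; rewrite (side p yp np) (side r yr nr).
by apply: pq'; rewrite (side p yp np) (side q yq nq).
Qed.

End Colors.

Lemma isomorphic_subgroups_trans (G H L : groupType) (A : set G) (B : set H)
    (C : set L) : isomorphic_subgroups A B -> isomorphic_subgroups B C ->
  isomorphic_subgroups A C.
Proof.
move=> [f fb fM] [g gb gM]; exists (g \o f); first exact: set_bij_comp fb gb.
have fA x : x \in A -> f x \in B by rewrite !inE; case: fb => + _ _; exact.
by move=> x y xA yA /=; rewrite fM// gM//; exact: fA.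
Qed.

Lemma isomorphic_subgroups_sym (G H : groupType) (A : set G) (B : set H) :
  (forall g h, A g -> A h -> A (g * h)%g) -> isomorphic_subgroups A B ->
  isomorphic_subgroups B A.
Proof.
move=> AM [f [fA fi fs] fM].
have [g hg] : exists g, forall y, B y -> A (g y) /\ f (g y) = y.
  have /choice [g hg] : forall y, exists x, B y -> A x /\ f x = y.
    move=> y; have [By|n] := pselect (B y); last by exists 1%g.
    by have [x Ax <-] := fs _ By; exists x.
  by exists g.
exists g; first split.
- by move=> y /hg[].
- by move=> y y'; rewrite !inE => /hg[_ e] /hg[_ e'] eg; rewrite -e -e' eg.
- move=> x Ax; have Bx := fA _ Ax; exists (f x) => //.
  by have [h1 h2] := hg _ Bx; apply: fi; rewrite ?inE.
- move=> y y'; rewrite !inE => By By'.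
  have [h1 h2] := hg _ By; have [h1' h2'] := hg _ By'.
  have BM : B (y * y')%g.
    by rewrite -h2 -h2' -fM ?inE//; apply: fA; exact: AM.
  have [h3 h4] := hg _ BM.
  by apply: fi; rewrite ?inE//; [exact: AM|rewrite h4 fM ?inE// h2 h2'].
Qed.

(** * From permutations of the branch points to homeomorphisms *)

Section Extension.
Local Open Scope ring_scope.
Variables (R : realType) (X : metricType R) (n : option nat).
Hypotheses (hn : at_least_three n) (hX : wazewski_dendrite X n).
Variable c : X -> set X -> segment n.
Hypothesis hc : kaleidoscopic c.
Variable Gamma : set (Sym (segment n)).
Hypothesis hG : group_closed [in Gamma].
Implicit Types p q : X.

Let cX : connected [set: X].
Proof. by case: hX => -[]. Qed.

Let lX : locally_connected X.
Proof. by case: hX => -[]. Qed.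

Notation B := (set_type (@Br R X)).
Notation G := (kaleido_group (color c) Gamma).
Implicit Types (x y z : B) (b : Sym B).

(* [extends b p q]: a homeomorphism extending b must send p to q. *)
Definition extends b p q := forall z y, z <> y ->
  branch (val z) (val y) p <-> branch (val (b z)) (val (b y)) q.

Lemma extendsV b p q : extends b p q -> extends (b^-1)%g q p.
Proof.
move=> h z y zy; have := h _ _ (sym_neq (g := (b^-1)%g) zy).
by rewrite !symKV => ->.
Qed.

Lemma group_branch_eq b x y z : G b -> x <> y -> x <> z ->
  branch (val x) (val y) = branch (val x) (val z) <->
  branch (val (b x)) (val (b y)) = branch (val (b x)) (val (b z)).
Proof.
move=> /(_ x)[s _ hs] xy xz.
rewrite -(colorE hc xy xz) -(colorE hc (sym_neq xy) (sym_neq xz)) !hs//.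
by split => [->|e] //; exact: sym_inj e.
Qed.

Lemma extends_val b x : G b -> extends b (val x) (val (b x)).
Proof.
move=> Gb z y zy; have [->|zx] := pselect (z = x).
  by split => /branch_neq.
have e := group_branch_eq Gb zy zx.
split => [/branch_eq/e e'|/branch_eq/e e']; apply: branchE => //.
  exact: val_neq (sym_neq zx).
exact: val_neq zx.
Qed.

Lemma extends_uniq b p q q' : extends b p q -> extends b p q' -> q = q'.
Proof.
move=> h h'; apply: contrapT => qq'.
have [w [Bw wq wq' nw]] := Br_separated hn hX hc qq'.
pose w' : B := SigSub (mem_set Bw).
have [y wy e] := color_onto hn hX hc (x := w') wq.
have zy := sym_neq (g := (b^-1)%g) wy.
have : branch (val w') (val y) q by apply: branchE.
rewrite -(symKV b w') -(symKV b y) => /(h _ _ zy) /(h' _ _ zy).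
by rewrite !symKV => /branch_eq e'; apply: nw; rewrite -e -e'.
Qed.

(* The image of p is a cluster point of the images of the branch points near p. *)
Lemma extends_exists b p : G b -> exists q, extends b p q.
Proof.
move=> Gb; have [Bp|nBp] := pselect (Br p).
  by exists (val (b (SigSub (mem_set Bp)))); exact: (extends_val (SigSub (mem_set Bp)) Gb).
pose F : set_system X := [set S | exists2 U, nbhs p U &
  forall z, U (val z) -> S (val (b z))].
have FF : ProperFilter F.
  split.
    move=> [U nU hU]; have [z Bz Uz] := Br_dense hn hX hc nU.
    exact: (hU (SigSub (mem_set Bz)) Uz).
  split.
  - by exists setT => //; exact: filterT.
  - move=> S S' [U nU hU] [U' nU' hU']; exists (U `&` U'); first exact: filterI.
    by move=> z [/hU ? /hU' ?].
  - by move=> S S' SS' [U nU hU]; exists U => // z /hU /SS'.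
have kX : compact [set: X] by case: hX => -[].
have [|q [_ cq]] := kX F FF.
  by exists setT => //; exact: filterT.
have inF z y : z <> y -> branch (val z) (val y) p ->
    closure (branch (val (b z)) (val (b y))) q.
  move=> zy pzy U nU; apply: cq => //.
  exists (branch (val z) (val y)); first exact: branch_nbhs.
  by move=> x /(extends_val x Gb zy).
have key z y : z <> y -> branch (val z) (val y) p ->
    branch (val (b z)) (val (b y)) q.
  (* Closing the branch adds only its root [val (b z)]. If [q] were this root, then [z] would lie in
     the branch of [p] at a point [w] separating them. *)
  move=> zy pzy; apply: (closure_branch lX) (inF _ _ zy pzy) _ => zq.
  have pz : p <> val z by move=> e; exact: (branch_neq pzy).
  have [w [Bw wp wz nw]] := Br_separated hn hX hc pz.
  pose w' : B := SigSub (mem_set Bw).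
  have [y' wy' e] := color_onto hn hX hc (x := w') wp.
  have w'z : w' <> z by move=> e'; apply: wz; rewrite -e'.
  have pw : branch (val w') (val y') p by apply: branchE.
  have : branch (val (b w')) (val (b y')) q.
    apply: (closure_branch lX) (inF _ _ wy' pw) _; rewrite -zq.
    by apply: val_neq; exact: sym_neq.
  rewrite -zq => /(extends_val z Gb wy') /branch_eq e'.
  by apply: nw; rewrite -e e'.
exists q => z y zy; split; first exact: key.
move=> qzy; have zp : val z <> p by move=> e; apply: nBp; rewrite -e; exact: set_valP.
have [y' zy' e] := color_onto hn hX hc zp.
have pz : branch (val z) (val y') p by apply: branchE.
have := branch_eq (key _ _ zy' pz); rewrite -(branch_eq qzy).
by move=> /(group_branch_eq Gb zy' zy) <-.
Qed.

(** By compactness it suffices that [g] clusters only at [g p] near [p]. Any other point is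
    separated from [g p] by a branch point, and the preimage of the branch of [g p] there is again a
    branch, hence open. *)
Lemma extends_continuous b (g : X -> X) : (forall p, extends b p (g p)) ->
  continuous g.
Proof.
move=> hg p; have kX : compact [set: X] by case: hX => -[].
apply: (compact_cluster_set1 (@metric_hausdorff _ X) kX).
- exact: filterT.
- by exact: filterT.
apply/seteqP; split => [q cq|_ -> S U /= nS nU]; last first.
  by exists (g p); split; [exact: (nbhs_singleton nS)|exact: nbhs_singleton].
apply: contrapT => /= qg.
have [w [Bw wq wg nw]] := Br_separated hn hX hc qg.
pose w' : B := SigSub (mem_set Bw).
have [y wy e] := color_onto hn hX hc (x := w') wg.
have zy := sym_neq (g := (b^-1)%g) wy.
have preim p' : branch (val ((b^-1)%g w')) (val ((b^-1)%g y)) p' <->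
    branch (val w') (val y) (g p').
  by have := hg p' _ _ zy; rewrite !symKV.
have gy : branch (val w') (val y) (g p) by apply: branchE.
have : (g @ p) (branch (val w') (val y)).
  apply: filterS (branch_nbhs lX (proj2 (preim p) gy)) => p'.
  by move=> /preim.
move=> /cq /(_ (branch_nbhs lX (branch_refl wq))) [t [h1 h2]].
by apply: nw; rewrite (branch_eq h2) -(branch_eq h1) e.
Qed.

Lemma extends_sym b : G b -> exists2 g : Sym X, Homeo g &
  forall p, extends b p (g p).
Proof.
move=> Gb; have Gb' := groupV hG Gb.
have [g hg] := choice (fun p => extends_exists p Gb).
have [h hh] := choice (fun p => extends_exists p Gb').
have gK : cancel g h.
  by move=> p; apply: (extends_uniq (hh (g p))); exact: extendsV.
have hK : cancel h g.
  move=> p; apply: (extends_uniq (hg (h p))).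
  by have := extendsV (hh p); rewrite invgK.
exists (MkSym gK hK) => //; split; first exact: extends_continuous hg.
exact: extends_continuous hh.
Qed.

Lemma continuous_branch (g : Sym X) p q r : continuous g ->
  branch p q r -> branch (g p) (g q) (g r).
Proof.
move=> cg h; have pq : p <> q.
  move=> e; move: h; rewrite /branch connected_component_out //.
  by move=> /(_ (esym e)).
apply: branchE; first by apply: sym_neq; exact: branch_neq h.
apply: (@connected_branch _ _ (g @` branch p q)).
- apply: connected_continuous_connected; first exact: branch_connected.
  exact: continuous_subspaceT.
- by move=> [t pqt e]; apply: (branch_neq pqt); exact: esym (sym_inj e).
- by exists q => //; exact: branch_refl.
- by exists r.
Qed.

Lemma homeo_branch (g : Sym X) p q : Homeo g ->
  g @` branch p q = branch (g p) (g q).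
Proof.
move=> [cg cV]; apply/seteqP; split => [_ [r h <-]|r h].
  exact: continuous_branch.
exists ((g^-1)%g r); last exact: symKV.
by have := continuous_branch cV h; rewrite !symVK.
Qed.

Lemma homeo_Br (g : Sym X) p : Homeo g -> Br p -> Br (g p).
Proof.
move=> hg /BrP[q [r [s [[pq pr ps] [qr qs rs]]]]].
apply/BrP; exists (g q), (g r), (g s); split; first by split; exact: sym_neq.
have inj u v : p <> v -> branch p u <> branch p v -> branch (g p) (g u) <> branch (g p) (g v).
  move=> pv nuv e; apply: nuv; apply: branch_eq.
  have : branch (g p) (g u) (g v) by rewrite e; apply: branch_refl; exact: sym_neq.
  by rewrite -homeo_branch// => -[t ht e']; rewrite -(sym_inj e').
by split; apply: inj.
Qed.

Lemma homeo_restrict (g : Sym X) : Homeo g ->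
  exists b : Sym B, forall x, val (b x) = g (val x).
Proof.
move=> hg; have hV : Homeo (g^-1)%g by case: hg => h1 h2; split; rewrite ?invgK.
pose f x : B := SigSub (mem_set (homeo_Br hg (set_valP x))).
pose f' x : B := SigSub (mem_set (homeo_Br hV (set_valP x))).
have fK : cancel f f' by move=> x; apply: val_inj => /=; exact: symVK.
have fV : cancel f' f by move=> x; apply: val_inj => /=; exact: symKV.
by exists (MkSym fK fV).
Qed.

Lemma local_actionE (g : Sym X) x p : Homeo g -> val x <> p ->
  local_action c g (val x) (c (val x) (branch (val x) p)) =
  c (g (val x)) (branch (g (val x)) (g p)).
Proof.
move=> hg xp; rewrite /local_action pinvKV ?homeo_branch//.
- by have [_ ci _] := proj1 hc _ (set_valP x).
- by rewrite inE; exact: branches_branch.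
Qed.

Lemma kaleidoscopic_group_restrict (g : Sym X) b : Homeo g ->
  (forall x, val (b x) = g (val x)) -> kaleidoscopic_group c Gamma g <-> G b.
Proof.
move=> hg hb; split => [[_ h] x|Gb].
  have [s Gs e] := h _ (set_valP x); exists s => // y xy.
  by rewrite /color e local_actionE ?hb//; exact: val_neq.
split => // p Bp; pose x : B := SigSub (mem_set Bp).
have [s Gs hs] := Gb x; exists s => //; apply/funext => i.
have [y [xy <-]] := kaleido_onto (kaleido_color hn hX hc) x i.
by rewrite -hs// /color !hb -(local_actionE hg (val_neq xy)).
Qed.

Lemma homeo_extends (g : Sym X) b : Homeo g ->
  (forall x, val (b x) = g (val x)) -> forall p, extends b p (g p).
Proof.
move=> hg hb p z y _; rewrite !hb -homeo_branch//; split => [h|[t h e]].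
  by exists p.
by rewrite -(sym_inj e).
Qed.

Lemma kaleidoscopic_group_Br :
  isomorphic_subgroups G (kaleidoscopic_group c Gamma).
Proof.
have [phi hphi] : exists phi : Sym B -> Sym X, forall b, G b ->
    Homeo (phi b) /\ forall x, val (b x) = phi b (val x).
  have /choice[phi h] : forall b, exists g : Sym X, G b ->
      Homeo g /\ forall x, val (b x) = g (val x).
    move=> b; have [Gb|nGb] := pselect (G b); last by exists 1%g.
    have [g hg eg] := extends_sym Gb; exists g => _; split => // x.
    exact: extends_uniq (extends_val x Gb) (eg (val x)).
  by exists phi.
have ext b g : Homeo g -> (forall x, val (b x) = g (val x)) ->
    G b -> g = phi b.
  move=> hg hb /hphi[hp hpb]; apply: symP => p.
  exact: extends_uniq (homeo_extends hg hb p) (homeo_extends hp hpb p).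
exists phi; first split.
- by move=> b Gb; have [h1 h2] := hphi _ Gb; apply/(kaleidoscopic_group_restrict h1 h2).
- move=> b b'; rewrite !inE => /hphi[_ h] /hphi[_ h'] e.
  by apply: symP => x; apply: val_inj; rewrite h h' e.
- move=> g Gg; have hg : Homeo g by case: Gg.
  have [b hb] := homeo_restrict hg.
  have Gb : G b by apply/(kaleidoscopic_group_restrict hg hb).
  by exists b => //; apply/esym/ext.
- move=> b b'; rewrite !inE => Gb Gb'; apply/esym/ext.
  + have [[h1 h2] _] := hphi _ Gb; have [[h1' h2'] _] := hphi _ Gb'.
    split; first by move=> p; apply: continuous_comp; [exact: h1'|exact: h1].
    rewrite invgM => p; apply: continuous_comp; [exact: h2|exact: h2'].
  + move=> x; have [_ h] := hphi _ Gb; have [_ h'] := hphi _ Gb'.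
    by rewrite !symM h h'.
  + exact: groupM.
Qed.

End Extension.

Theorem theorem1p3 (R : realType) (n n' : option nat)
    (hn : at_least_three n) (hn' : at_least_three n')
    (Gamma : set (Sym (segment n))) (Gamma' : set (Sym (segment n')))
    (hG : group_closed [in Gamma]) (hG' : group_closed [in Gamma'])
    (dG : discrete_subset Gamma) (dG' : discrete_subset Gamma')
    (X X' : metricType R)
    (hX : wazewski_dendrite X n) (hX' : wazewski_dendrite X' n')
    (c : X -> set X -> segment n) (c' : X' -> set X' -> segment n')
    (hc : kaleidoscopic c) (hc' : kaleidoscopic c')
    (hiso : isomorphic_subgroups (kaleidoscopic_group c Gamma)
                                 (kaleidoscopic_group c' Gamma')) :
  n = n' /\ permutation_isomorphic Gamma Gamma'.
Proof.
have iso := isomorphic_subgroups_trans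
  (kaleidoscopic_group_Br hn hX hc hG) hiso.
have iso' : isomorphic_subgroups (kaleido_group (color c) Gamma)
    (kaleido_group (color c') Gamma').
  apply: (isomorphic_subgroups_trans iso); apply: isomorphic_subgroups_sym.
    by move=> g h; exact: groupM.
  exact: (kaleidoscopic_group_Br hn' hX' hc' hG').
have perm := kaleido_group_iso (kaleido_color hn hX hc)
  (kaleido_color hn' hX' hc') (segment3 hn) (segment3 hn')
  (Br_type_countable hX) (Br_type_countable hX') (Br_type_nonempty hn hX hc)
  hG hG' iso'.
by split => //; have [f /segment_inj] := perm.
Qed.
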